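(* For each $N\in\mathbb{N}$ let $\delta_N\in(0,1)$ and let $$\hat q=\hat q_{N,\delta_N}=(1-\delta_N)\hat q_N+\delta_N\varphi$$ be an $N$-dependent defensive random proposal density with associated random measure $\hat Q$, and let $P$, $p$, $f\in L^2(P)$, $X_1,\dots,X_n$, $Z\sim P$ be as specified in the context. Let $\eta>0$ and suppose that $\mathrm{MISE}(\hat q_N)=\mathcal{O}(N^{-2\eta})$ and $\delta_N\asymp N^{-\eta/2}$. Let $\tilde p=c\,p$ with $c>0$, let $0<\tau<c$, and let $$\mathcal{I}_n(f)=\frac1n\sum_{i=1}^n\frac{pf}{\hat q}(X_i),\quad \mathcal{I}^{\mathrm{SN}}_n(f)=\frac{\sum_{i=1}^n\frac{\tilde p f}{\hat q}(X_i)}{\sum_{i=1}^n\frac{\tilde p}{\hat q}(X_i)},\quad \mathcal{I}^{\mathrm{SN},\tau}_n(f)=\frac{\sum_{i=1}^n\frac{\tilde p f}{\hat q}(X_i)}{\max\bigl(\tau n,\sum_{i=1}^n\frac{\tilde p}{\hat q}(X_i)\bigr)} .$$ Then each of the estimators $\mathcal{I}^\ast_n\in\{\mathcal{I}_n,\mathcal{I}^{\mathrm{SN}}_n,\mathcal{I}^{\mathrm{SN},\tau}_n\}$ satisfies $$\mathbb{E}\bigl[|\mathcal{I}_n^\ast(f)-\mathcal{I}(f)|\bigr]\le\frac1{\sqrt n}\Bigl(\operatorname{Var}[f(Z)]^{1/2}+\mathcal{O}\bigl(N^{-\eta/4}\bigr)\Bigr),$$ where for $\mathcal{I}^\ast_n=\mathcal{I}^{\mathrm{SN}}_n$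 it is additionally required that $\mathbb{E}\bigl[\|f\|_{L^4(\hat Q)}^4\bigr]$ is finite.
   Context: Setting. $(\Omega,\Sigma,\mathbb{P})$ is a probability space; $\mathcal{P}(\mathbb{R}^d)$ is the space of Borel probability measures on $\mathbb{R}^d$ with the Borel $\sigma$-algebra of the weak topology. $P\in\mathcal{P}(\mathbb{R}^d)$ has strictly positive Lebesgue density $p$; $\mathcal{I}(f)=\int fp\,\mathrm{d}x$. $\varphi$ is a fixed deterministic probability density that is strictly positive on $\mathbb{R}^d$. For each $N$, $\hat q_N$ is a random probability density, and the random proposal $\hat Q$ with density $\hat q_{N,\delta_N}$ is a $\mathcal{P}(\mathbb{R}^d)$-valued random variable, measurable with respect to a sub-$\sigma$-algebra $\mathcal{F}\subseteq\Sigma$, with $P\ll\hat Q$ a.s. Conditionally on $\hat Q$, $X_1,\dots,X_n$ are conditionally independent with common distribution $\hat Q$. $Z\sim P$ is independent of $\mathcal{F}$. The following integrability conditions hold: $$\Bigl\|\tfrac{f^2\sqrt p}{\varphi}\Bigr\|_{L^2(P)}<\infty,\quad \Bigl\|\tfrac{\sqrt p}{\varphi}\Bigr\|_{L^2(P)}<\infty,\quad \int_{\mathbb{R}^d}|p-\varphi|f^2\,\mathrm{d}x<\infty,\quad \mathrm{MISE}(\hat q_N)<\infty .$$ $\mathrm{MISE}(\hat q_N)=\mathbb{E}\int_{\mathbb{R}^d}(\hat q_N(x)-p(x))^2\,\mathrm{d}x$, and $\|f\|_{L^4(\hat Q)}^4=\int f^4\,\mathrm{d}\hat Q$. $a_N\asymp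 b_N$ means that $a_N/b_N$ is bounded above and below by positive constants. $\mathcal{O}(\cdot)$ is as $N\to\infty$ with constants independent of $N$ and $n$.
   Formalization: For the self-normalised estimator, E‖f‖⁴ in L⁴(Q̂) is required to be bounded uniformly in N (finiteness for each N is not enough), and the random density q̂ is taken jointly measurable with respect to σ(Q̂) and the Borel sets. *)

(* Defs.v *)
From HB Require Import structures.
From mathcomp Require Import all_boot all_order all_algebra.
From mathcomp Require Import all_classical all_reals all_analysis.
Set Implicit Arguments.
Unset Strict Implicit.
Unset Printing Implicit Defensive.
Import Order.TTheory GRing.Theory Num.Theory.
Import numFieldNormedType.Exports.
Local Open Scope classical_set_scope.
Local Open Scope ring_scope.

(* R^d is d.-tuple R with the library's product sigma-algebra.  The library
   has no Lebesgue measure on it; it is built here as the d-fold product of the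
   one-dimensional one (see lebesgueRd_box). *)
Section lebesgueRd.
Context {R : realType}.

Definition lebesgue_cons n (mu : set (n.-tuple R) -> \bar R) :
    set (n.+1.-tuple R) -> \bar R :=
  pushforward (lebesgue_measure \x mu)%E
    (fun z : measurableTypeR R * n.-tuple R => [tuple of z.1 :: z.2]).

Let measurable_tcons n : measurable_fun setT
  (fun z : measurableTypeR R * n.-tuple R =>
     [tuple of z.1 :: z.2] : n.+1.-tuple R).
Proof.
exact: (@measurable_cons _ _ (measurableTypeR R * n.-tuple R)%type R
  (fun z => z.1) n (fun z => z.2) measurable_fst measurable_snd).
Qed.

Section step.
Context n (mu : {sigma_finite_measure set (n.-tuple R) -> \bar R}).

Let lc0 : lebesgue_cons mu set0 = 0%E.
Proof. by rewrite /lebesgue_cons /pushforward preimage_set0 measure0. Qed.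

Let lc_ge0 A : (0 <= lebesgue_cons mu A)%E.
Proof. by rewrite /lebesgue_cons /pushforward measure_ge0. Qed.

Let lc_sigma_additive : semi_sigma_additive (lebesgue_cons mu).
Proof.
pose g : {mfun (measurableTypeR R * n.-tuple R)%type >-> n.+1.-tuple R} :=
  mfun_Sub (mem_set (@measurable_tcons n)).
exact: (@measure_semi_sigma_additive _ _ _
  (pushforward (lebesgue_measure \x mu)%E g)).
Qed.

HB.instance Definition _ := isMeasure.Build _ _ _ (lebesgue_cons mu)
  lc0 lc_ge0 lc_sigma_additive.

Let lc_sigma_finite : sigma_finite setT (lebesgue_cons mu).
Proof.
have /sigma_finiteP[F [TF ndF Foo]] := sigma_finiteT (@lebesgue_measure R).
have /sigma_finiteP[G [TG ndG Goo]] := sigma_finiteT mu.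
pose u (t : n.+1.-tuple R) : measurableTypeR R * n.-tuple R :=
  (thead t, [tuple of behead t]).
have mtu : measurable_fun setT u.
  apply/measurable_fun_pairP; split.
    exact: (@measurable_tnth _ R n.+1 ord0).
  exact: (@measurable_behead _ R n).
have uK (z : measurableTypeR R * n.-tuple R) : u [tuple of z.1 :: z.2] = z.
  by case: z => x t; rewrite /u theadE; congr pair; apply/val_inj.
exists (fun k => u @^-1` (F k `*` G k)).
  apply/seteqP; split => // t _.
  have [i _ Fi] : (\bigcup_i F i) (u t).1 by rewrite -TF.
  have [j _ Gj] : (\bigcup_i G i) (u t).2 by rewrite -TG.
  exists (maxn i j) => //=; split.
  - by move: Fi; exact/subsetPset/ndF/leq_maxl.
  - by move: Gj; exact/subsetPset/ndG/leq_maxr.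
move=> k; have [mFk Fk] := Foo k; have [mGk Gk] := Goo k; split.
  by rewrite -[X in measurable X]setTI; apply: mtu => //; exact: measurableX.
rewrite /lebesgue_cons /pushforward (_ : _ @^-1` _ = F k `*` G k).
  by rewrite product_measure1E// lte_mul_pinfty// ge0_fin_numE.
by rewrite -comp_preimage (_ : _ \o _ = id) ?preimage_id//; apply/funext/uK.
Qed.

HB.instance Definition _ := Measure_isSigmaFinite.Build _ _ _
  (lebesgue_cons mu) lc_sigma_finite.

End step.

Fixpoint lebesgueRd (d : nat) :
    {sigma_finite_measure set (d.-tuple R) -> \bar R} :=
  match d with
  | 0 => [the {sigma_finite_measure set (0.-tuple R) -> \bar R} of
          dirac [tuple]]
  | n.+1 => [the {sigma_finite_measure set (n.+1.-tuple R) -> \bar R} of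
             lebesgue_cons (lebesgueRd n)]
  end.

Lemma lebesgueRd_box d (A : 'I_d -> set R) : (forall i, measurable (A i)) ->
  lebesgueRd d [set x | forall i, A i (tnth x i)] =
  (\prod_(i < d) @lebesgue_measure R (A i))%E.
Proof.
elim: d A => [A _|n IH A mA].
  rewrite big_ord0 /= diracE mem_set//; by case.
have mB : measurable [set x : n.-tuple R | forall i, A (lift ord0 i) (tnth x i)].
  rewrite [X in measurable X](_ : _ = \bigcap_(i in [set: 'I_n])
      ((fun x : n.-tuple R => tnth x i) @^-1` A (lift ord0 i))).
    apply: fin_bigcap_measurable => [|i _]; first exact: finite_finset.
    rewrite -[X in measurable X]setTI.
    exact: (@measurable_tnth _ R n i measurableT _ (mA _)).
  by apply/seteqP; split=> x /= h i //=; exact: h.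
rewrite big_ord_recl -(IH (fun i => A (lift ord0 i)))//=.
rewrite /lebesgue_cons /pushforward /= -product_measure1E//; last exact: mA.
congr product_measure1; apply/seteqP; split=> -[x t] /= h.
  split; first by have := h ord0.
  by move=> i; have := h (lift ord0 i); rewrite tnthS.
move=> i; case: (unliftP ord0 i) => [j|] ->; last exact: h.1.
by rewrite tnthS; apply: h.2.
Qed.

End lebesgueRd.

Section densities.
Context {R : realType} (d : nat).
Implicit Types p : d.-tuple R -> R.

Definition is_pdf p : Prop :=
  [/\ measurable_fun setT p, forall x, 0 <= p x
    & (\int[lebesgueRd d]_x (p x)%:E = 1)%E].

Definition has_density (mu : set (d.-tuple R) -> \bar R) p : Prop :=
  forall A, measurable A -> mu A = (\int[lebesgueRd d]_(x in A) (p x)%:E)%E.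

Definition defensive (delta : R) p phi : d.-tuple R -> R :=
  fun x => (1 - delta) * p x + delta * phi x.

End densities.

Section estimators.
Context {R : realType} (d n : nat).
Implicit Types (p pt q f : d.-tuple R -> R) (x : 'I_n -> d.-tuple R).

Definition IS p q f x : R := n%:R^-1 * \sum_(i < n) p (x i) * f (x i) / q (x i).

Definition SNIS pt q f x : R :=
  (\sum_(i < n) pt (x i) * f (x i) / q (x i)) /
  (\sum_(i < n) pt (x i) / q (x i)).

Definition SNIS_trunc (tau : R) pt q f x : R :=
  (\sum_(i < n) pt (x i) * f (x i) / q (x i)) /
  Num.max (tau * n%:R) (\sum_(i < n) pt (x i) / q (x i)).

End estimators.

Section conditioning.
Context {dO dT : measure_display} {Omega : measurableType dO}
  {T : measurableType dT} {R : realType} (Pr : probability Omega R).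
Implicit Types (G : set_system Omega) (Q : Omega -> pprobability T R).

(* g is a version of the conditional probability Pr(E | G) *)
Definition cond_prob G (E : set Omega) (g : Omega -> R) : Prop :=
  [/\ forall B, measurable B -> G (g @^-1` B),
      Pr.-integrable setT (EFin \o g)
    & forall A, G A -> (\int[Pr]_(w in A) (g w)%:E = Pr (E `&` A))%E].

Definition cond_law G (X : Omega -> T) Q : Prop :=
  forall A, measurable A -> cond_prob G (X @^-1` A) (fun w => fine (Q w A)).

(* Subfamilies are covered by taking A i = setT for the other indices. *)
Definition cond_indep G n (X : 'I_n -> Omega -> T) : Prop :=
  forall (A : 'I_n -> set T) (g : 'I_n -> Omega -> R),
    (forall i, measurable (A i)) ->
    (forall i, cond_prob G (X i @^-1` A i) (g i)) ->
    cond_prob G [set w | forall i, A i (X i w)] (fun w => \prod_(i < n) g i w).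

(* pprobability T R carries the sigma-algebra generated by the evaluations
   mu |-> mu A; on a Polish space T this is the Borel sigma-algebra of the weak
   topology.  g_sigma_algebra_preimage Q is the sigma-algebra sigma(Q). *)
Definition cond_iid Q n (X : 'I_n -> Omega -> T) : Prop :=
  cond_indep (g_sigma_algebra_preimage Q) X /\
  forall i, cond_law (g_sigma_algebra_preimage Q) (X i) Q.

Definition indep_of (Z : Omega -> T) G : Prop :=
  forall A B, G A -> measurable B ->
    (Pr (A `&` Z @^-1` B) = Pr A * Pr (Z @^-1` B))%E.

(* (w, x) |-> q w x is measurable for the product of sigma(Q) and the
   sigma-algebra of T: the random function q is determined by Q, pointwise. *)
Definition measurable_given Q (q : Omega -> T -> R) : Prop :=
  measurable_fun [set: g_sigma_algebra_preimageType Q * T]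
    (fun z => q z.1 z.2).

End conditioning.

Section rates.
Context {R : realType}.

Definition MISE {dO} {Omega : measurableType dO} (Pr : probability Omega R) {d}
    (q : Omega -> d.-tuple R -> R) (p : d.-tuple R -> R) : \bar R :=
  (\int[Pr]_w \int[lebesgueRd d]_x ((q w x - p x) ^+ 2)%:E)%E.

(* Indices start at 1, since 0 `^ a is 0 (or 1 for a = 0). *)
Definition asymp (a b : nat -> R) : Prop :=
  exists c C : R, [/\ 0 < c, 0 < C
    & forall N, (0 < N)%N -> c <= a N / b N <= C].

(* err N n <= n^(-1/2) (sigma + O(N^(- eta / 4))), with the O-term the same
   for all n. *)
Definition error_rate (err : nat -> nat -> \bar R) (sigma : \bar R) (eta : R)
    : Prop :=
  exists2 r : nat -> R, r =O_\oo (fun N => N%:R `^ (- (eta / 4)))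
    & forall N n, (0 < n)%N ->
        (err N n <= ((Num.sqrt n%:R)^-1)%:E * (sigma + (r N)%:E))%E.

End rates.

(* Main.v *)
Require Import Defs.
From HB Require Import structures.
From mathcomp Require Import all_boot all_order all_algebra.
From mathcomp Require Import all_classical all_reals all_analysis.
From mathcomp Require Import measurable_realfun.
From mathcomp Require Import lra ring.
Set Implicit Arguments.
Unset Strict Implicit.
Unset Printing Implicit Defensive.
Import Order.TTheory GRing.Theory Num.Theory.
Import numFieldNormedType.Exports.
Local Open Scope classical_set_scope.
Local Open Scope ring_scope.

(** Put [w = p / q] and let [A], [B] be the averages of [w f] and of [w] over the
    sample. The first estimator is [A]; the constant [c] cancels in the other two,
    which are [A / B] and [A / max (tau / c) B].

    Whatever the realised proposal, the summands of [A] have conditional mean [I],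
    the density of the proposal cancelling against the denominator, and two
    distinct summands are uncorrelated ([expectation_weightM]). Hence the mean
    square error of [A] is the expectation of the integral of [(p f) ^ 2 / q],
    minus [I ^ 2], divided by [n] ([IS_mean_square]); the same holds for [B], with
    1 in place of [f]. Conditional laws are given on rectangles only, and
    [conditional_transfer] extends them to functions by a Dynkin argument.

    For [q = p] the numerator would be the variance of [f (Z)]. The defensive
    mixture keeps [q] above [delta phi] at the price of a bias of order [delta],
    and the pointwise bound [defensive_weight_bound] turns this into an excess of
    order [rho ^ 2 = m / delta + delta / (1 - delta)], where [m] is of the order of
    the root of the mean integrated squared error ([second_moment_excess]). With
    the prescribed rates, [rho] is of order [N ^ (- eta / 4)]
    ([excess_rate_bound]). Taking square roots gives the bound for [A].

    For the ratios, the deviation of [B] from 1 is of order [rho / sqrt n], because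
    the constant function 1 has variance 0. As long as the denominator is bounded
    below, dividing by it therefore changes the error by [O (rho) / sqrt n]
    ([truncated_ratio_error]). Without truncation the event [B < 1/2] has to be
    paid for. There [A / B] is a weighted mean of the values [f (X i)], so for
    every [lam] it is at most [lam] plus the sum of their fourth powers divided by
    [lam ^ 3] ([ratio_error]); the event has probability of order [rho ^ 2 / n],
    and [lam = sqrt n / rho] makes both contributions [O (rho) / sqrt n]. *)

(** * Integrals of weighted push-forwards *)

Section weighted_transfer.
Import HBNNSimple.
Context {R : realType} {dY} {Y : measurableType dY}.
Local Open Scope ereal_scope.

Lemma integral_setC_split d (M : measurableType d)
    (m : {measure set M -> \bar R}) (k : M -> R) (A : set M) :
  measurable_fun [set: M] k -> (forall x, (0 <= k x)%R) -> measurable A ->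
  \int[m]_(x in A) (k x)%:E + \int[m]_(x in ~` A) (k x)%:E = \int[m]_x (k x)%:E.
Proof.
move=> mk k0 mA; have mC := measurableC mA.
have mk' : measurable_fun (A `|` ~` A) (fun x => (k x)%:E).
  by apply/measurable_EFinP; exact: measurable_funTS.
have k0' x : (A `|` ~` A) x -> 0 <= (k x)%:E by rewrite lee_fin.
have dA : [disjoint A & ~` A] by apply/disj_setPS; rewrite setICr.
by rewrite -(ge0_integral_setU m mA mC mk' k0' dA) setUv.
Qed.

(** Splitting a simple function over its range reduces an integral to the
    measures of the fibres, which is what a law controls. *)
Lemma integral_weighted_nnsfun d (M : measurableType d)
    (m : {measure set M -> \bar R}) (g : M -> Y) (k : M -> R)
    (h : {nnsfun Y >-> R}) :
  measurable_fun [set: M] g -> measurable_fun [set: M] k ->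
  (forall x, (0 <= k x)%R) ->
  \int[m]_x ((h (g x))%:E * (k x)%:E) =
  \sum_(y \in range h)
     (y%:E * \int[m]_(x in g @^-1` (h @^-1` [set y])) (k x)%:E).
Proof.
move=> mg mk k0.
under eq_integral => x _.
  rewrite fimfunE -fsumEFin// ge0_mule_fsuml; last first.
    by move=> y; rewrite EFinM nnfun_muleindic_ge0.
  over.
have mi y : measurable_fun [set: M] (fun x => \1_(h @^-1` [set y]) (g x) : R).
  by apply: measurableT_comp.
rewrite ge0_integral_fsum//; last 2 first.
- move=> y; apply: emeasurable_funM; last exact/measurable_EFinP.
  by apply/measurable_EFinP; exact: measurable_funM.
- by move=> y x _; apply: mule_ge0; [by rewrite EFinM nnfun_muleindic_ge0|rewrite lee_fin].
apply: eq_fsbigr => y; rewrite inE => -[z _ zy].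
under eq_integral do rewrite EFinM -muleA.
rewrite ge0_integralZl//; last 3 first.
- apply: emeasurable_funM; first exact/measurable_EFinP.
  exact/measurable_EFinP.
- by move=> x _; rewrite mule_ge0// lee_fin.
- by rewrite lee_fin -zy.
congr (_ * _); rewrite [RHS]integral_mkcond.
by apply: eq_integral => x _; rewrite epatch_indic muleC.
Qed.

Lemma integral_weighted_lim d (M : measurableType d)
    (m : {measure set M -> \bar R}) (g : M -> Y) (k : M -> R) (u : Y -> \bar R)
    (mu : measurable_fun [set: Y] u) :
  measurable_fun [set: M] g -> measurable_fun [set: M] k ->
  (forall x, (0 <= k x)%R) -> (forall y, 0 <= u y) ->
  \int[m]_x (u (g x) * (k x)%:E) =
  limn (fun n => \int[m]_x ((nnsfun_approx measurableT mu n (g x))%:E * (k x)%:E)).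
Proof.
move=> mg mk k0 u0; set h := nnsfun_approx _ _.
have uE x : u (g x) * (k x)%:E = limn (fun n => (h n (g x))%:E * (k x)%:E).
  by apply/esym/cvg_lim => //; apply: cvgeZr => //; exact: cvg_nnsfun_approx.
under eq_integral => x _ do rewrite uE.
apply: monotone_convergence => //.
- move=> n; apply: emeasurable_funM; apply/measurable_EFinP => //.
  exact: measurableT_comp.
- by move=> n x _; rewrite mule_ge0 ?lee_fin.
- move=> x _ a b ab; rewrite lee_wpmul2r ?lee_fin//.
  exact/lefP/nd_nnsfun_approx.
Qed.

Context d1 d2 (M1 : measurableType d1) (M2 : measurableType d2).
Context (m1 : {measure set M1 -> \bar R}) (m2 : {measure set M2 -> \bar R})
  (g1 : M1 -> Y) (g2 : M2 -> Y) (k1 : M1 -> R) (k2 : M2 -> R).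
Hypotheses (mg1 : measurable_fun [set: M1] g1) (mg2 : measurable_fun [set: M2] g2)
  (mk1 : measurable_fun [set: M1] k1) (mk2 : measurable_fun [set: M2] k2)
  (k1_ge0 : forall x, (0 <= k1 x)%R) (k2_ge0 : forall x, (0 <= k2 x)%R).

(** A weight and a map push a measure forward. Two such push-forwards that
    agree on sets agree on functions, by approximation from below with simple
    functions; working with weights avoids constructing the image measures. *)
Lemma integral_weighted_transfer (u : Y -> \bar R) :
  (forall E, measurable E ->
    \int[m1]_(x in g1 @^-1` E) (k1 x)%:E = \int[m2]_(x in g2 @^-1` E) (k2 x)%:E) ->
  measurable_fun [set: Y] u -> (forall y, 0 <= u y) ->
  \int[m1]_x (u (g1 x) * (k1 x)%:E) = \int[m2]_x (u (g2 x) * (k2 x)%:E).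
Proof.
move=> agree mu u0; rewrite !(integral_weighted_lim _ mu)//; congr (limn _).
apply/funext => n; rewrite !integral_weighted_nnsfun//; apply: eq_fsbigr => y _.
by rewrite agree.
Qed.

(** Dynkin's argument. Finiteness is what allows passing to complements, by
    subtraction from the total mass. *)
Lemma integral_weighted_pi_system (G : set (set Y)) :
  @measurable _ Y = <<s G >> -> setI_closed G -> G [set: Y] ->
  \int[m1]_x (k1 x)%:E < +oo ->
  (forall E, G E ->
    \int[m1]_(x in g1 @^-1` E) (k1 x)%:E = \int[m2]_(x in g2 @^-1` E) (k2 x)%:E) ->
  forall E, measurable E ->
    \int[m1]_(x in g1 @^-1` E) (k1 x)%:E = \int[m2]_(x in g2 @^-1` E) (k2 x)%:E.
Proof.
move=> GE GI GT fin1 agree.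
have mpre1 E : measurable E -> measurable (g1 @^-1` E).
  by move=> mE; rewrite -[X in measurable X]setTI; exact: mg1.
have mpre2 E : measurable E -> measurable (g2 @^-1` E).
  by move=> mE; rewrite -[X in measurable X]setTI; exact: mg2.
have mk1' E : measurable_fun E (fun x => (k1 x)%:E).
  by apply/measurable_EFinP; exact: measurable_funTS.
have mk2' E : measurable_fun E (fun x => (k2 x)%:E).
  by apply/measurable_EFinP; exact: measurable_funTS.
suff H E : <<s G >> E ->
    \int[m1]_(x in g1 @^-1` E) (k1 x)%:E = \int[m2]_(x in g2 @^-1` E) (k2 x)%:E.
  by move=> E mE; apply: H; rewrite -GE.
move: E; apply: (@dynkin_induction _ Y G (fun E =>
  \int[m1]_(x in g1 @^-1` E) (k1 x)%:E = \int[m2]_(x in g2 @^-1` E) (k2 x)%:E));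
  [exact: GE|exact: GI|exact: agree GT|exact: agree| | ].
- move=> S mS PS.
  have split1 := integral_setC_split m1 mk1 k1_ge0 (mpre1 _ mS).
  have split2 := integral_setC_split m2 mk2 k2_ge0 (mpre2 _ mS).
  have finS : \int[m1]_(x in g1 @^-1` S) (k1 x)%:E \is a fin_num.
    rewrite ge0_fin_numE; last by apply: integral_ge0 => x _; rewrite lee_fin.
    apply: le_lt_trans fin1; rewrite -split1 leeDl//.
    by apply: integral_ge0 => x _; rewrite lee_fin.
  have tot : \int[m1]_x (k1 x)%:E = \int[m2]_x (k2 x)%:E := agree _ GT.
  have -> : g1 @^-1` (~` S) = ~` (g1 @^-1` S) by [].
  have -> : g2 @^-1` (~` S) = ~` (g2 @^-1` S) by [].
  rewrite -[LHS](addeK _ finS) -[RHS](addeK _ finS); congr (_ - _).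
  by rewrite addeC split1 tot PS addeC split2.
- move=> F mF tF PF.
  have bigcupE d (M : measurableType d) (m : {measure set M -> \bar R})
      (g : M -> Y) (k : M -> R) :
      (forall E, measurable E -> measurable (g @^-1` E)) ->
      measurable_fun [set: M] k -> (forall x, (0 <= k x)%R) ->
      \int[m]_(x in g @^-1` (\bigcup_n F n)) (k x)%:E =
      \sum_(0 <= n <oo) \int[m]_(x in g @^-1` (F n)) (k x)%:E.
    move=> mpre mk k0; rewrite preimage_bigcup ge0_integral_bigcup//.
    + by move=> n; exact: mpre.
    + by apply/measurable_EFinP; exact: measurable_funTS.
    + by move=> x _; rewrite lee_fin.
    + by move=> i j _ _ [x [Fi Fj]]; apply: (tF i j) => //; exists (g x).
  rewrite (bigcupE _ _ m1)// (bigcupE _ _ m2)//.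
  by apply: eq_eseriesr => n _; exact: PF.
Qed.

End weighted_transfer.

(** * Sampling from a random law *)

Section conditional_transfer.
Context {R : realType} {dO dT : measure_display} {Omega : measurableType dO}
  {T : measurableType dT} (Pr : probability Omega R)
  (leb : {sigma_finite_measure set T -> \bar R}).
Variables (Q : Omega -> pprobability T R) (q : Omega -> T -> R).
Local Notation OQ := (g_sigma_algebra_preimageType Q).
Hypotheses (Q_sub : g_sigma_algebra_preimage Q `<=` @measurable _ Omega)
  (q_meas : measurable_given Q q) (q_ge0 : forall w x, 0 <= q w x)
  (Q_q : forall w A, measurable A -> Q w A = (\int[leb]_(x in A) (q w x)%:E)%E).

(** The sigma-algebra generated by [Q] is coarser than the ambient one, so the
    identity is measurable in this direction only. *)
Lemma measurable_forget : measurable_fun [set: Omega] (id : Omega -> OQ).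
Proof. by move=> _ B mB; rewrite setTI preimage_id; exact: Q_sub. Qed.

Lemma measurable_with_info (X : Omega -> T) : measurable_fun [set: Omega] X ->
  measurable_fun [set: Omega] (fun w => (w, X w) : OQ * T).
Proof.
by move=> mX; apply: measurable_fun_pair => //; exact: measurable_forget.
Qed.

Lemma measurable_forget_pair :
  measurable_fun [set: Omega * T] (id : Omega * T -> OQ * T).
Proof.
apply/measurable_fun_pairP; split; last exact: measurable_snd.
by apply: (measurableT_comp measurable_forget); exact: measurable_fst.
Qed.

Local Open Scope ereal_scope.

(** Disintegration: a law known on rectangles [G] x [A], with [G] in the
    sigma-algebra of the random measure [Q], determines the expectation of
    every function of [(w, X w)], even a function that depends on [w] through
    [Q]. The weight [k] makes the lemma composable: a function of a second
    sample can be carried along as [k], its conditional mean being [s]. *)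
Lemma conditional_transfer (X : Omega -> T) (k : Omega -> R) (s : OQ -> R)
    (u : OQ * T -> \bar R) :
  measurable_fun [set: Omega] X -> measurable_fun [set: Omega] k ->
  measurable_fun [set: OQ] s ->
  (forall w, (0 <= k w)%R) -> (forall w, (0 <= s w)%R) ->
  \int[Pr]_w (k w)%:E < +oo ->
  (forall (G : set OQ) A, measurable G -> measurable A ->
    \int[Pr]_(w in G `&` X @^-1` A) (k w)%:E =
    \int[Pr]_(w in G) ((s w)%:E * Q w A)) ->
  measurable_fun [set: OQ * T] u -> (forall z, 0 <= u z) ->
  \int[Pr]_w (u (w, X w) * (k w)%:E) =
  \int[Pr]_w ((s w)%:E * \int[leb]_x (u (w, x) * (q w x)%:E)).
Proof.
move=> mX mk ms k0 s0 kfin agree mu u0.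
have ms' : measurable_fun [set: Omega] s.
  exact: (measurableT_comp ms measurable_forget).
have mq : measurable_fun [set: Omega * T] (fun z => q z.1 z.2).
  exact: (measurableT_comp q_meas measurable_forget_pair).
have mqw w : measurable_fun [set: T] (q w).
  exact: (@measurable_fun_pair2 _ _ _ _ _ _ (fun z : OQ * T => q z.1 z.2) w q_meas).
pose k2 (z : Omega * T) : R := (s z.1 * q z.1 z.2)%R.
have mk2 : measurable_fun [set: Omega * T] k2.
  apply: measurable_funM => //.
  exact: (measurableT_comp ms' measurable_fst).
have k20 z : (0 <= k2 z)%R by rewrite mulr_ge0.
have muw w : measurable_fun [set: T] (fun x => u (w, x)).
  exact: (@measurable_fun_pair2 _ _ _ _ _ _ u w mu).
have mu' : measurable_fun [set: Omega * T] u.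
  exact: (measurableT_comp mu measurable_forget_pair).
rewrite (@integral_weighted_transfer _ _ _ _ _ _ _ Pr (Pr \x leb)%E
  (fun w => (w, X w) : OQ * T) id k k2)//; last 3 first.
- exact: measurable_with_info.
- exact: measurable_forget_pair.
- pose C : set (set (OQ * T)) :=
    [set A `*` B | A in @measurable _ OQ & B in @measurable _ T].
  apply: (@integral_weighted_pi_system _ _ _ _ _ _ _ _ _ _ _ _ _ _ _ _ _ _ _ C)
      => //.
  + exact: measurable_with_info.
  + exact: measurable_forget_pair.
  + exact: measurable_prod_measurableType.
  + move=> _ _ [X1 mX1 [X2 mX2 <-]] [Y1 mY1 [Y2 mY2 <-]]; rewrite -setXI.
    exists (X1 `&` Y1); first exact: measurableI.
    by exists (X2 `&` Y2) => //; exact: measurableI.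
  + by exists setT => //; exists setT => //; rewrite setXTT.
  + move=> _ [G mG [A mA <-]]; rewrite (_ : _ @^-1` _ = G `&` X @^-1` A)//.
    have mG' : @measurable _ Omega G by exact: Q_sub.
    rewrite agree// preimage_id [RHS]integral_mkcond [LHS]integral_mkcond.
    rewrite fubini_tonelli1; last 2 first.
    * apply/(measurable_restrict _ _ _) => //; first exact: measurableX.
      exact/measurable_EFinP/measurable_funTS.
    * by move=> z; apply: erestrict_ge0 => // x _; rewrite lee_fin.
    apply: eq_integral => w _; rewrite /fubini_F !patchE.
    case: ifPn => wG; last first.
      rewrite integral0_eq// => x _; rewrite patchE ifF//.
      by apply/negbTE/negP => /set_mem[wG' _]; move: wG; rewrite mem_set.
    rewrite Q_q// -ge0_integralZl//; last 3 first.
    * exact/measurable_EFinP/measurable_funTS.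
    * by move=> x _; rewrite lee_fin.
    * by rewrite lee_fin.
    rewrite integral_mkcond; apply: eq_integral => x _; rewrite !patchE.
    rewrite (_ : ((w, x) \in _) = (x \in A)) ?EFinM//.
    by move: wG => /set_mem wG; apply/idP/idP => [/set_mem[_ xA]|/set_mem xA];
      apply/mem_set.
rewrite fubini_tonelli1; last 2 first.
- by apply: emeasurable_funM => //; exact/measurable_EFinP.
- by move=> z; rewrite mule_ge0 ?lee_fin.
apply: eq_integral => w _; rewrite /fubini_F -ge0_integralZl//; last 3 first.
- by apply: emeasurable_funM => //; exact/measurable_EFinP.
- by move=> x _; rewrite mule_ge0 ?lee_fin.
- by rewrite lee_fin.
by apply: eq_integral => x _; rewrite /k2/= EFinM muleCA.
Qed.

End conditional_transfer.

Lemma integral_cst_probability {R : realType} d (T : measurableType d)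
    (Pr : probability T R) (a : \bar R) : (\int[Pr]_w a = a)%E.
Proof.
rewrite integral_cst// -[RHS]mule1; congr (_ * _)%E; exact: probability_setT.
Qed.

Section sampling.
Context {R : realType} {dO dT : measure_display} {Omega : measurableType dO}
  {T : measurableType dT} (Pr : probability Omega R)
  (leb : {sigma_finite_measure set T -> \bar R}).
Variables (Q : Omega -> pprobability T R) (q : Omega -> T -> R).
Local Notation OQ := (g_sigma_algebra_preimageType Q).
Hypotheses (Q_sub : g_sigma_algebra_preimage Q `<=` @measurable _ Omega)
  (q_meas : measurable_given Q q) (q_ge0 : forall w x, 0 <= q w x)
  (Q_q : forall w A, measurable A -> Q w A = (\int[leb]_(x in A) (q w x)%:E)%E).

Local Open Scope ereal_scope.

Lemma integral_cond_law (X : Omega -> T) (u : OQ * T -> \bar R) :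
  measurable_fun [set: Omega] X ->
  cond_law Pr (g_sigma_algebra_preimage Q) X Q ->
  measurable_fun [set: OQ * T] u -> (forall z, 0 <= u z) ->
  \int[Pr]_w u (w, X w) = \int[Pr]_w \int[leb]_x (u (w, x) * (q w x)%:E).
Proof.
move=> mX XQ mu u0.
transitivity (\int[Pr]_w (u (w, X w) * (1%R : R)%:E)).
  by apply: eq_integral => w _; rewrite mule1.
rewrite (@conditional_transfer _ _ _ _ _ Pr leb Q q Q_sub q_meas q_ge0 Q_q
  X (fun=> 1%R) (fun=> 1%R) u)//.
- by apply: eq_integral => w _; rewrite mul1e.
- by rewrite integral_cst// mul1e -ge0_fin_numE ?fin_num_measure//.
- move=> G A mG mA; under [RHS]eq_integral do rewrite mul1e.
  have mG' : @measurable _ Omega G by exact: Q_sub.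
  have mXA : measurable (X @^-1` A) by rewrite -[X in measurable X]setTI; exact: mX.
  rewrite integral_cst ?mul1e//; last exact: measurableI.
  have [_ _ /(_ G mG) lawG] := XQ A mA.
  rewrite (_ : G `&` _ = X @^-1` A `&` G); last by rewrite setIC.
  apply: etrans (esym lawG) _.
  by apply: eq_integral => w _; rewrite fineK// fin_num_measure.
Qed.

Lemma prod_two_indices n (i j : 'I_n) (g : 'I_n -> R) : i != j ->
  (forall l, l != i -> l != j -> g l = 1%R) -> (\prod_(l < n) g l = g i * g j)%R.
Proof.
move=> ij g1; rewrite (bigD1 i)//= (bigD1 j) ?(eq_sym j)//= big1 ?mulr1//.
by move=> l /andP[]; exact: g1.
Qed.

(** Product rule for the pair of indices [i], [j]: the remaining coordinates
    are tested on the full space, where the conditional probability is 1. *)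
Lemma cond_iid_pair n (X : 'I_n -> Omega -> T) (i j : 'I_n) (G : set OQ)
    (A B : set T) : cond_iid Pr Q X -> i != j ->
  measurable G -> measurable A -> measurable B ->
  Pr (G `&` X i @^-1` A `&` X j @^-1` B) =
  \int[Pr]_(w in G) ((fine (Q w B))%:E * Q w A).
Proof.
move=> [indep law] ij mG mA mB.
pose C (l : 'I_n) := if l == i then A else if l == j then B else setT.
have mC l : measurable (C l) by rewrite /C; case: ifP => // _; case: ifP.
have ji : (j == i) = false by rewrite eq_sym; exact/negbTE.
have [_ _ /(_ G mG) indepG] := indep C _ mC (fun l => law l _ (mC l)).
rewrite (_ : _ `&` _ = [set w | forall l, C l (X l w)] `&` G).
  apply: etrans (esym indepG) _.
  apply: eq_integral => w _; rewrite (prod_two_indices ij) => [|l li lj].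
    have QA : Q w A \is a fin_num by exact: fin_num_measure.
    by rewrite /C eqxx ji eqxx -[in RHS](fineK QA) -EFinM mulrC.
  by rewrite /C (negbTE li) (negbTE lj) probability_setT.
apply/seteqP; split => w /=.
  move=> [[Gw Aw] Bw]; split => // l; rewrite /C.
  by case: eqP => [->//|_]; case: eqP => [->//|].
by move=> [CX Gw]; have := CX i; have := CX j; rewrite /C ji !eqxx.
Qed.

(** Conditionally on [Q] the two factors are independent. The disintegration
    is applied twice: to [X i] with the event that [X j] is in [B] as weight,
    then to [X j] with [u (w, X i w)] as weight. The hypothesis that the
    conditional means do not depend on [w] holds for importance weights, whose
    conditional mean is an integral against the target. *)
Lemma expectation_cond_iidM n (X : 'I_n -> Omega -> T) (i j : 'I_n)
    (u v : OQ * T -> R) (a b : R) :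
  (forall l, measurable_fun [set: Omega] (X l)) -> cond_iid Pr Q X -> i != j ->
  measurable_fun [set: OQ * T] u -> measurable_fun [set: OQ * T] v ->
  (forall z, (0 <= u z)%R) -> (forall z, (0 <= v z)%R) ->
  (forall w, \int[leb]_x (u (w, x) * q w x)%:E = a%:E) ->
  (forall w, \int[leb]_x (v (w, x) * q w x)%:E = b%:E) ->
  \int[Pr]_w (u (w, X i w) * v (w, X j w))%:E = (a * b)%:E.
Proof.
move=> mX iid ij mu mv u0 v0 ua vb.
have mQ B : measurable B -> measurable_fun [set: OQ] (fun w => fine (Q w B)).
  by move=> mB _ E mE; rewrite setTI; have [+ _ _] := iid.2 i B mB; exact.
have mw w0 : measurable_fun [set: T] (q w0).
  exact: (@measurable_fun_pair2 _ _ _ _ _ _ (fun z : OQ * T => q z.1 z.2) w0 q_meas).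
have muw w0 : measurable_fun [set: T] (fun x => u (w0, x)).
  exact: (@measurable_fun_pair2 _ _ _ _ _ _ u w0 mu).
have a0 : (0 <= a)%R.
  by rewrite -lee_fin -(ua point) integral_ge0// => x _; rewrite lee_fin mulr_ge0.
have muX : measurable_fun [set: Omega] (fun w => u (w, X i w)).
  exact: (measurableT_comp mu (measurable_with_info Q_sub (mX i))).
have mpre l (B : set T) : measurable B -> measurable (X l @^-1` B).
  by move=> mB; rewrite -[X in measurable X]setTI; exact: mX.
have step (G : set OQ) (B : set T) : measurable G -> measurable B ->
    \int[Pr]_(w in G `&` X j @^-1` B) (u (w, X i w))%:E =
    \int[Pr]_(w in G) (a%:E * Q w B).
  move=> mG mB.
  have mG' : @measurable _ Omega G by exact: Q_sub.
  pose uG (z : OQ * T) := (\1_G z.1 * u z)%:E.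
  have muG : measurable_fun [set: OQ * T] uG.
    apply/measurable_EFinP; apply: measurable_funM => //.
    by apply: (measurableT_comp (measurable_indic mG)); exact: measurable_fst.
  have := @conditional_transfer _ _ _ _ _ Pr leb Q q Q_sub q_meas q_ge0 Q_q
    (X i) (\1_(X j @^-1` B)) (fun w => fine (Q w B)) uG (mX i).
  have -> : \int[Pr]_w (uG (w, X i w) * (\1_(X j @^-1` B) w)%:E) =
      \int[Pr]_(w in G `&` X j @^-1` B) (u (w, X i w))%:E.
    rewrite [RHS]integral_mkcond; apply: eq_integral => w _.
    by rewrite epatch_indic /uG/= indicI/= !EFinM muleAC muleC muleA.
  move=> ->//.
  - rewrite [RHS]integral_mkcond; apply: eq_integral => w _.
    rewrite epatch_indic.
    have -> : \int[leb]_x (uG (w, x) * (q w x)%:E) = (\1_G w)%:E * a%:E.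
      rewrite -(ua w) -ge0_integralZl//.
      + by apply: eq_integral => x _; rewrite /uG/= -!EFinM mulrA.
      + by apply/measurable_EFinP; exact: measurable_funM.
      + by move=> x _; rewrite lee_fin mulr_ge0.
    by rewrite fineK ?fin_num_measure// muleC -muleA muleC.
  - exact: measurable_indic (mpre j _ mB).
  - exact: mQ.
  - by move=> w; rewrite fine_ge0// measure_ge0.
  - rewrite integral_indic ?setIT//; last exact: mpre.
    by rewrite -ge0_fin_numE// fin_num_measure//; exact: mpre.
  - move=> G' A mG1 mA.
    rewrite -(cond_iid_pair iid ij)// integral_indic; last 2 first.
    + by apply: measurableI; [exact: Q_sub|exact: mpre].
    + exact: mpre.
    by rewrite setIC.
  - by move=> z; rewrite lee_fin mulr_ge0.
transitivity (\int[Pr]_w ((EFin \o v) (w, X j w) * (u (w, X i w))%:E)).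
  by apply: eq_integral => w _; rewrite /= EFinM muleC.
rewrite (@conditional_transfer _ _ _ _ _ Pr leb Q q Q_sub q_meas q_ge0 Q_q
  (X j) (fun w => u (w, X i w)) (fun=> a) (EFin \o v))//.
- under eq_integral => w _.
    under eq_integral do rewrite /= -EFinM.
    rewrite vb -EFinM; over.
  exact: integral_cst_probability.
- have muE : measurable_fun [set: OQ * T] (EFin \o u) by apply/measurable_EFinP.
  rewrite (@integral_cond_law (X i) (EFin \o u) (mX i) (iid.2 i) muE)//.
  under eq_integral => w _.
    under eq_integral do rewrite /= -EFinM.
    rewrite ua; over.
  by rewrite integral_cst_probability ltry.
- exact/measurable_EFinP.
Qed.

End sampling.

(** * Uncorrelated averages *)

Section second_moments.
Context {R : realType} {d} {T : measurableType d}.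
Local Open Scope ereal_scope.

Lemma Lnorm_even_power (mu : {measure set T -> \bar R}) (k : nat) (f : T -> R) :
  ~~ odd k -> (0 < k)%N ->
  'N[mu]_k%:R%:E[EFin \o f] `^ k%:R = \int[mu]_x (f x ^+ k)%:E.
Proof.
move=> ek k0; rewrite poweR_Lnorm ?pnatr_eq0 -?lt0n//.
apply: eq_integral => x _; by rewrite /= powR_mulrn// -normrX ger0_norm//
  exprn_even_ge0.
Qed.

Lemma Lfun2_sqr_integral (mu : {measure set T -> \bar R}) (f : T -> R) :
  measurable_fun [set: T] f -> \int[mu]_x (f x ^+ 2)%:E < +oo ->
  f \in Lfun mu 2%:E.
Proof.
move=> mf ffin; rewrite inE; apply/andP; split; rewrite inE//=.
rewrite /finite_norm; set N := 'N[mu]_2%:E[_].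
have -> : N = (N `^ 2) `^ 2^-1 by rewrite -poweRrM divff// poweRe1// Lnorm_ge0.
by apply: poweR_lty; rewrite (Lnorm_even_power mu (k := 2) f).
Qed.

Context (Pr : probability T R).

Lemma expectation_fun_sum (I : eqType) (s : seq I) (F : I -> T -> R) :
  (forall i, F i \in Lfun Pr 1) ->
  'E_Pr[fun w => (\sum_(i <- s) F i w)%R] = \sum_(i <- s) 'E_Pr[F i].
Proof.
move=> F1; have := @expectation_sum _ _ _ Pr [seq F i | i <- s].
rewrite !big_map => <-; last by move=> _ /mapP[i _ ->].
by congr expectation; apply/funext => w; rewrite fct_sumE.
Qed.

(** The cross terms of the expanded square vanish, which leaves [n] terms out
    of [n ^ 2]. *)
Lemma mean_square_average n (Y : 'I_n -> T -> R) (mu S : R) : (0 < n)%N ->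
  (forall i, Y i \in Lfun Pr 2%:E) -> (forall i, 'E_Pr[Y i] = mu%:E) ->
  (forall i j, i != j -> 'E_Pr[(Y i \* Y j)%R] = (mu ^+ 2)%:E) ->
  (forall i, 'E_Pr[(Y i \* Y i)%R] <= S%:E) ->
  'E_Pr[fun w => ((n%:R^-1 * \sum_(i < n) Y i w - mu) ^+ 2)%R] <=
    ((S - mu ^+ 2) / n%:R)%:E.
Proof.
move=> n0 Y2 EY EYY EYS.
have Pfin : Pr [set: T] \is a fin_num by exact: fin_num_measure.
have Y1 i : Y i \in Lfun Pr 1 by apply: Lfun_subset12.
pose D i : T -> R := (Y i \- cst mu)%R.
have D2 i : D i \in Lfun Pr 2%:E.
  by rewrite /D rpredB ?lee1n ?Y2//= => _; rewrite Lfun_cst.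
have DD1 i j : (D i \* D j)%R \in Lfun Pr 1 by apply: Lfun2_mul_Lfun1.
have EDD i j : 'E_Pr[(D i \* D j)%R] = 'E_Pr[(Y i \* Y j)%R] - (mu ^+ 2)%:E.
  have -> : 'E_Pr[(D i \* D j)%R] = covariance Pr (Y i) (Y j).
    by rewrite covariance.unlock !EY.
  rewrite covarianceE//; last exact: Lfun2_mul_Lfun1.
  by rewrite !EY -EFinM expr2.
have -> : (fun w => ((n%:R^-1 * \sum_(i < n) Y i w - mu) ^+ 2)%R) =
    (n%:R ^- 2 \o* (fun w => \sum_(i < n) \sum_(j < n) (D i \* D j) w))%R.
  apply/funext => w /=.
  have -> : (n%:R^-1 * \sum_(i < n) Y i w - mu = n%:R^-1 * \sum_(i < n) D i w)%R.
    rewrite sumrB/= mulrBr; congr (_ - _)%R.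
    rewrite sumr_const card_ord -[(mu *+ n)%R]mulr_natl mulrA mulVf ?mul1r//.
    by rewrite pnatr_eq0 -lt0n.
  rewrite exprMn exprVn mulrC; congr (_ * _)%R.
  by rewrite expr2 big_distrlr.
pose row i : T -> R := fun w => (\sum_(j < n) (D i \* D j) w)%R.
have row1 i : row i \in Lfun Pr 1.
  rewrite (_ : row i = \sum_(j < n) (D i \* D j))%R; last first.
    by apply/funext => w; rewrite fct_sumE.
  by rewrite rpred_sum// => j _; exact: DD1.
have Erow i : 'E_Pr[row i] <= (S - mu ^+ 2)%:E.
  rewrite /row (expectation_fun_sum _ (DD1 i)) (bigD1 i)//= big1 ?adde0 => [|j ji].
    by rewrite EDD EFinB leeB.
  by rewrite EDD EYY ?subee// eq_sym.
rewrite (expectationZl _ (X := fun w => \sum_(i < n) row i w)%R); last first.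
  rewrite (_ : (fun w => _) = \sum_(i < n) row i)%R; last first.
    by apply/funext => w; rewrite fct_sumE.
  by rewrite rpred_sum// => i _; exact: row1.
rewrite (expectation_fun_sum _ row1).
apply: (@le_trans _ _ ((n%:R ^- 2)%:E * (n%:R * (S - mu ^+ 2))%:E)).
  rewrite lee_wpmul2l ?lee_fin ?invr_ge0 ?exprn_ge0//.
  apply: (le_trans (lee_sum _ (fun i _ => Erow i))).
  by rewrite sumEFin sumr_const card_ord -[X in (X <= _)%E]/(_%:E) mulr_natl.
rewrite -EFinM lee_fin le_eqVlt; apply/orP; left; apply/eqP.
by field; rewrite pnatr_eq0 -lt0n.
Qed.
End second_moments.

(** * Moments of importance weights *)

(** Writing the inverse as a real power makes its measurability that of the
    power function. *)
Lemma measurable_fun_inv_gt0 {R : realType} d (T : measurableType d) (f : T -> R) :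
  (forall x, 0 < f x) -> measurable_fun [set: T] f ->
  measurable_fun [set: T] (fun x => (f x)^-1).
Proof.
move=> f0 mf; rewrite (_ : (fun x => _) = (fun x => f x `^ -1)).
  exact: (measurableT_comp (measurable_powR _) mf).
by apply/funext => x; rewrite powR_inv1// ltW.
Qed.

Lemma Lfun1_ge0_integral {R : realType} d (T : measurableType d)
    (mu : {measure set T -> \bar R}) (f : T -> R) :
  measurable_fun [set: T] f -> (forall x, 0 <= f x) ->
  (\int[mu]_x (f x)%:E < +oo)%E -> f \in Lfun mu 1.
Proof.
move=> mf f0 ffin; apply/Lfun1_integrable/integrableP; split.
  exact/measurable_EFinP.
by under eq_integral do rewrite /= ger0_norm//.
Qed.

Section importance_sampling.
Context {R : realType} {dO dT : measure_display} {Omega : measurableType dO}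
  {T : measurableType dT} (Pr : probability Omega R)
  (leb : {sigma_finite_measure set T -> \bar R}).
Variables (Q : Omega -> pprobability T R) (q : Omega -> T -> R).
Local Notation OQ := (g_sigma_algebra_preimageType Q).
Hypotheses (Q_sub : g_sigma_algebra_preimage Q `<=` @measurable _ Omega)
  (q_meas : measurable_given Q q) (q_gt0 : forall w x, 0 < q w x)
  (Q_q : forall w A, measurable A -> Q w A = (\int[leb]_(x in A) (q w x)%:E)%E).
Variables (n : nat) (X : 'I_n -> Omega -> T).
Hypotheses (mX : forall i, measurable_fun [set: Omega] (X i))
  (X_iid : cond_iid Pr Q X).

Let q_ge0 w x : 0 <= q w x. Proof. exact: ltW. Qed.

Lemma measurable_weight (g : T -> R) : measurable_fun [set: T] g ->
  measurable_fun [set: OQ * T] (fun z => g z.2 / q z.1 z.2).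
Proof.
move=> mg; apply: measurable_funM.
  exact: (measurableT_comp mg measurable_snd).
exact: (@measurable_fun_inv_gt0 _ _ _ (fun z : OQ * T => q z.1 z.2)).
Qed.

Lemma measurable_sampled_weight (g : T -> R) i : measurable_fun [set: T] g ->
  measurable_fun [set: Omega] (fun w => g (X i w) / q w (X i w)).
Proof.
move=> mg.
exact: (measurableT_comp (measurable_weight mg) (measurable_with_info Q_sub (mX i))).
Qed.

Local Open Scope ereal_scope.

(** The density of the proposal cancels against the denominators, so that the
    conditional means are the integrals of [g] and [h], whatever the realised
    proposal. *)
Lemma expectation_weightM (g h : T -> R) (a b : R) i j : i != j ->
  measurable_fun [set: T] g -> measurable_fun [set: T] h ->
  (forall x, (0 <= g x)%R) -> (forall x, (0 <= h x)%R) ->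
  \int[leb]_x (g x)%:E = a%:E -> \int[leb]_x (h x)%:E = b%:E ->
  \int[Pr]_w (g (X i w) / q w (X i w) * (h (X j w) / q w (X j w)))%:E
    = (a * b)%:E.
Proof.
move=> ij mg mh g0 h0 ga hb.
apply: (@expectation_cond_iidM _ _ _ _ _ Pr leb Q q Q_sub q_meas q_ge0 Q_q n X i j
  (fun z => g z.2 / q z.1 z.2) (fun z => h z.2 / q z.1 z.2))%R => //.
- exact: measurable_weight.
- exact: measurable_weight.
- by move=> z; rewrite divr_ge0.
- by move=> z; rewrite divr_ge0.
- by move=> w; rewrite -ga; apply: eq_integral => x _; rewrite /= divfK// gt_eqF.
- by move=> w; rewrite -hb; apply: eq_integral => x _; rewrite /= divfK// gt_eqF.
Qed.

Lemma expectation_weight (g : T -> R) i :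
  measurable_fun [set: T] g -> (forall x, (0 <= g x)%R) ->
  \int[Pr]_w (g (X i w) / q w (X i w))%:E = \int[leb]_x (g x)%:E.
Proof.
move=> mg g0.
have mu : measurable_fun [set: OQ * T] (fun z => (g z.2 / q z.1 z.2)%:E).
  by apply/measurable_EFinP; exact: measurable_weight.
rewrite (@integral_cond_law _ _ _ _ _ Pr leb Q q Q_sub q_meas q_ge0 Q_q
  (X i) (fun z => (g z.2 / q z.1 z.2)%:E) (mX i) (X_iid.2 i) mu); last first.
  by move=> z; rewrite lee_fin divr_ge0.
under eq_integral => w _.
  rewrite (eq_integral (fun x => (g x)%:E)); last first.
    by move=> x _; rewrite /= -EFinM divfK// gt_eqF.
  over.
exact: integral_cst_probability.
Qed.

Lemma expectation_sqr_weight (g : T -> R) i : measurable_fun [set: T] g ->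
  \int[Pr]_w ((g (X i w) / q w (X i w)) ^+ 2)%:E =
  \int[Pr]_w \int[leb]_x (g x ^+ 2 / q w x)%:E.
Proof.
move=> mg.
have mu : measurable_fun [set: OQ * T] (fun z => ((g z.2 / q z.1 z.2) ^+ 2)%:E).
  by apply/measurable_EFinP; apply: measurable_funX; exact: measurable_weight.
rewrite (@integral_cond_law _ _ _ _ _ Pr leb Q q Q_sub q_meas q_ge0 Q_q
  (X i) (fun z => ((g z.2 / q z.1 z.2) ^+ 2)%:E) (mX i) (X_iid.2 i) mu); last first.
  by move=> z; rewrite lee_fin sqr_ge0.
apply: eq_integral => w _; apply: eq_integral => x _; rewrite -EFinM; congr EFin.
by rewrite /= exprMn -mulrA; congr (_ * _)%R; rewrite exprVn expr2 invfM mulfVK// gt_eqF.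
Qed.

(** Positive and negative parts of [g] are treated separately, since the
    transfer results concern nonnegative functions; the four products
    recombine into the square of the mean. *)
Lemma IS_mean_square (g : T -> R) (mu S : R) : (0 < n)%N ->
  measurable_fun [set: T] g -> leb.-integrable [set: T] (EFin \o g) ->
  \int[leb]_x (g x)%:E = mu%:E ->
  \int[Pr]_w \int[leb]_x (g x ^+ 2 / q w x)%:E <= S%:E ->
  'E_Pr[fun w => ((n%:R^-1 * \sum_(i < n) g (X i w) / q w (X i w) - mu) ^+ 2)%R]
    <= ((S - mu ^+ 2) / n%:R)%:E.
Proof.
move=> n0 mg ig gmu gS.
have mgp : measurable_fun [set: T] (g^\+)%R by exact: measurable_funrpos.
have mgn : measurable_fun [set: T] (g^\-)%R by exact: measurable_funrneg.
have gp0 x : (0 <= (g^\+)%R x)%R by rewrite funrpos_ge0.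
have gn0 x : (0 <= (g^\-)%R x)%R by rewrite funrneg_ge0.
have gE x : g x = ((g^\+)%R x - (g^\-)%R x)%R by rewrite -[in LHS](funrposBneg g).
have [a ga] : exists a, \int[leb]_x ((g^\+)%R x)%:E = a%:E.
  have := integrable_fin_num measurableT (integrable_funrpos measurableT ig).
  by move=> /fineK <-; eexists.
have [b gb] : exists b, \int[leb]_x ((g^\-)%R x)%:E = b%:E.
  have := integrable_fin_num measurableT (integrable_funrneg measurableT ig).
  by move=> /fineK <-; eexists.
have muE : mu = (a - b)%R.
  apply/EFin_inj; rewrite -gmu EFinB -ga -gb -integralB_EFin//.
  - by apply: eq_integral => x _; rewrite gE.
  - exact: integrable_funrpos.
  - exact: integrable_funrneg.
pose Y i w := (g (X i w) / q w (X i w))%R.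
pose Yp i w := ((g^\+)%R (X i w) / q w (X i w))%R.
pose Yn i w := ((g^\-)%R (X i w) / q w (X i w))%R.
have YE i : Y i = (Yp i \- Yn i)%R.
  by apply/funext => w; rewrite /Y /Yp /Yn gE mulrBl.
have mYp i : measurable_fun [set: Omega] (Yp i) by exact: measurable_sampled_weight.
have mYn i : measurable_fun [set: Omega] (Yn i) by exact: measurable_sampled_weight.
have Yp0 i w : (0 <= Yp i w)%R by rewrite divr_ge0.
have Yn0 i w : (0 <= Yn i w)%R by rewrite divr_ge0.
have Yp1 i : Yp i \in Lfun Pr 1.
  by apply: Lfun1_ge0_integral => //; rewrite expectation_weight// ga ltry.
have Yn1 i : Yn i \in Lfun Pr 1.
  by apply: Lfun1_ge0_integral => //; rewrite expectation_weight// gb ltry.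
have EYp i : 'E_Pr[Yp i] = a%:E by rewrite unlock -ga -(expectation_weight i).
have EYn i : 'E_Pr[Yn i] = b%:E by rewrite unlock -gb -(expectation_weight i).
have prod (U V : 'I_n -> Omega -> R) c i j :
    (forall i, measurable_fun [set: Omega] (U i)) ->
    (forall i, measurable_fun [set: Omega] (V i)) ->
    (forall i w, (0 <= U i w)%R) -> (forall i w, (0 <= V i w)%R) ->
    \int[Pr]_w (U i w * V j w)%:E = c%:E ->
    (U i \* V j)%R \in Lfun Pr 1 /\ 'E_Pr[(U i \* V j)%R] = c%:E.
  move=> mU mV U0 V0 UVc; split; last by rewrite unlock.
  apply: Lfun1_ge0_integral.
  - exact: measurable_funM.
  - by move=> w; rewrite mulr_ge0.
  - by rewrite UVc ltry.
apply: (mean_square_average n0 (Y := Y)).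
- move=> i; apply: Lfun2_sqr_integral; first exact: measurable_sampled_weight.
  by rewrite expectation_sqr_weight// (le_lt_trans gS)// ltry.
- by move=> i; rewrite YE expectationB// EYp EYn -EFinB muE.
- move=> i j ij.
  have [pp1 Epp] := prod Yp Yp _ i j mYp mYp Yp0 Yp0
    (expectation_weightM ij mgp mgp gp0 gp0 ga ga).
  have [pn1 Epn] := prod Yp Yn _ i j mYp mYn Yp0 Yn0
    (expectation_weightM ij mgp mgn gp0 gn0 ga gb).
  have [np1 Enp] := prod Yn Yp _ i j mYn mYp Yn0 Yp0
    (expectation_weightM ij mgn mgp gn0 gp0 gb ga).
  have [nn1 Enn] := prod Yn Yn _ i j mYn mYn Yn0 Yn0
    (expectation_weightM ij mgn mgn gn0 gn0 gb gb).
  rewrite (_ : (Y i \* Y j)%R = ((Yp i \* Yp j \+ Yn i \* Yn j) \-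
      (Yp i \* Yn j \+ Yn i \* Yp j))%R); last first.
    by apply/funext => w; rewrite !YE/=; ring.
  rewrite expectationB ?rpredD//= !expectationD// Epp Epn Enp Enn.
  by rewrite -!EFinD muE; congr EFin; ring.
- move=> i; rewrite unlock; apply: le_trans gS.
  by rewrite -(expectation_sqr_weight i).
Qed.

End importance_sampling.

(** * Cost of a defensive proposal *)

(** The excess of [p ^ 2 / q] over [p] is [p (p - q) / q]. In it, the part of
    [p - q] due to [qN] is divided by [q >= delta phi]. The part [delta (p -
    phi)] matters only where [p >= phi]; there [p] is replaced by [qN] plus [p
    - qN], and [qN / q] is at most [1 / (1 - delta)]. Thus [|p - phi|] appears
    without the unbounded factor [p / phi]. *)
Lemma defensive_weight_bound (R : realFieldType) (p phi qN q delta : R) :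
  0 < p -> 0 < phi -> 0 <= qN -> 0 < delta < 1 ->
  q = (1 - delta) * qN + delta * phi ->
  p ^+ 2 / q <= p + p / phi * `|qN - p| / delta
                + delta / (1 - delta) * `|p - phi|.
Proof.
move=> p0 phi0 qN0 /andP[d0 d1] qE.
have d1' : 0 < 1 - delta by rewrite subr_gt0.
have q0 : 0 < q by rewrite qE ltr_wpDl ?mulr_ge0 ?mulr_gt0// ltW.
rewrite ler_pdivrMr//.
set D := `|qN - p|; set E := `|p - phi|.
have pD : p <= qN + D by rewrite -lerBlDl -(opprB qN) (le_trans (ler_norm _))// normrN.
have pE : p <= phi + E by rewrite -lerBlDl ler_norm.
have D0 : 0 <= D by rewrite normr_ge0.
have E0 : 0 <= E by rewrite normr_ge0.
have -> : (p + p / phi * D / delta + delta / (1 - delta) * E) * q =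
    p * q + p * D * (q / (delta * phi)) + delta * E * (q / (1 - delta)).
  by field; rewrite !gt_eqF.
have t1 : 1 + (1 - delta) * qN / (delta * phi) = q / (delta * phi).
  by rewrite qE; field; rewrite !gt_eqF.
have t2 : qN + delta * phi / (1 - delta) = q / (1 - delta).
  by rewrite qE; field; rewrite gt_eqF.
have d0' := ltW d0; have d1w := ltW d1'; have p0' := ltW p0; have phi0' := ltW phi0.
have l1 : p * D <= p * D * (q / (delta * phi)).
  have ge1 : 1 <= q / (delta * phi).
    by rewrite -t1 lerDl; apply: divr_ge0; apply: mulr_ge0.
  by apply: ler_peMr => //; apply: mulr_ge0.
have l2 : delta * E * qN <= delta * E * (q / (1 - delta)).
  have geqN : qN <= q / (1 - delta).
    by rewrite -t2 lerDl; apply: divr_ge0 => //; apply: mulr_ge0.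
  by apply: ler_wpM2l => //; apply: mulr_ge0.
apply: (@le_trans _ _ (p * q + p * D + delta * E * qN)); last by lra.
have first_term : p * (1 - delta) * (p - qN) <= p * (1 - delta) * D.
  by apply: ler_wpM2l; [apply: mulr_ge0 | rewrite lerBlDl].
have second_term : p * delta * (p - phi) <= delta * E * qN + p * delta * D.
  have [phip|pphi] := leP phi p; last first.
    apply: (@le_trans _ _ 0); first by apply: mulr_ge0_le0;
      [apply: mulr_ge0|rewrite subr_le0 ltW].
    by apply: addr_ge0; repeat apply: mulr_ge0.
  have -> : p - phi = E by rewrite /E ger0_norm ?subr_ge0.
  have Ep : E <= p by rewrite /E ger0_norm ?subr_ge0// lerBlDr lerDl ltW.
  have : delta * E * p <= delta * E * (qN + D) by apply: ler_wpM2l => //; apply: mulr_ge0.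
  have : delta * D * E <= delta * D * p by apply: ler_wpM2l => //; apply: mulr_ge0.
  by lra.
by rewrite qE; nra.
Qed.

Lemma second_moment_integrand_bound (R : realFieldType) (p phi qN q f delta m : R) :
  0 < p -> 0 < phi -> 0 <= qN -> 0 < delta < 1 -> 0 < m ->
  q = (1 - delta) * qN + delta * phi ->
  (p * f) ^+ 2 / q <= p * f ^+ 2 + (m / (2 * delta) * (p * f ^+ 2 / phi) ^+ 2
    + ((2 * delta * m)^-1 * (qN - p) ^+ 2
    + delta / (1 - delta) * (`|p - phi| * f ^+ 2))).
Proof.
move=> p0 phi0 qN0 /andP[d0 d1] m0 qE.
have d01 : 0 < delta < 1 by rewrite d0.
have f20 : 0 <= f ^+ 2 by rewrite sqr_ge0.
have := ler_wpM2r f20 (defensive_weight_bound p0 phi0 qN0 d01 qE).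
set D := `|qN - p|; set u := p * f ^+ 2 / phi.
have -> : (p * f) ^+ 2 / q = p ^+ 2 / q * f ^+ 2 by rewrite exprMn mulrAC.
have -> : (p + p / phi * D / delta + delta / (1 - delta) * `|p - phi|) * f ^+ 2 =
    p * f ^+ 2 + (u * D / delta + delta / (1 - delta) * (`|p - phi| * f ^+ 2)).
  by rewrite /u; ring.
move=> /le_trans; apply; rewrite lerD2l addrA lerD2r.
have -> : (qN - p) ^+ 2 = D ^+ 2 by rewrite /D real_normK// num_real.
(* Young's inequality for the product of u and D, with weight m *)
rewrite -subr_ge0.
have -> : m / (2 * delta) * u ^+ 2 + (2 * delta * m)^-1 * D ^+ 2 - u * D / delta =
    (2 * delta * m)^-1 * (m * u - D) ^+ 2 by field; rewrite !gt_eqF.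
by rewrite mulr_ge0 ?sqr_ge0// invr_ge0 !mulr_ge0// ltW.
Qed.

Section excess.
Context {R : realType} {dO dT : measure_display} {Omega : measurableType dO}
  {T : measurableType dT} (Pr : probability Omega R)
  (leb : {sigma_finite_measure set T -> \bar R}).
Local Open Scope ereal_scope.

Lemma ge0_integral_affine d (M : measurableType d) (mu : {measure set M -> \bar R})
    (g h : M -> \bar R) (k : R) :
  measurable_fun [set: M] g -> measurable_fun [set: M] h -> (forall x, 0 <= g x) ->
  (forall x, 0 <= h x) -> (0 <= k)%R ->
  \int[mu]_x (k%:E * g x + h x) = k%:E * \int[mu]_x g x + \int[mu]_x h x.
Proof.
move=> mg mh g0 h0 k0; rewrite ge0_integralD//; last 2 first.
- by move=> x _; rewrite mule_ge0// lee_fin.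
- by apply: emeasurable_funM => //; exact: measurable_cst.
by rewrite ge0_integralZl.
Qed.

Variables (p phi f : T -> R) (qN q : Omega -> T -> R) (delta m V H K : R).
Hypotheses (mp : measurable_fun [set: T] p) (mphi : measurable_fun [set: T] phi)
  (mf : measurable_fun [set: T] f)
  (mqN : measurable_fun [set: Omega * T] (fun z => qN z.1 z.2))
  (mq : measurable_fun [set: Omega * T] (fun z => q z.1 z.2))
  (p_gt0 : forall x, (0 < p x)%R) (phi_gt0 : forall x, (0 < phi x)%R)
  (qN_ge0 : forall w x, (0 <= qN w x)%R) (delta01 : (0 < delta < 1)%R)
  (m_gt0 : (0 < m)%R)
  (qE : forall w x, q w x = ((1 - delta) * qN w x + delta * phi x)%R).
Hypotheses (HV : \int[leb]_x (p x * f x ^+ 2)%:E <= V%:E)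
  (HH : \int[leb]_x ((p x * f x ^+ 2 / phi x) ^+ 2)%:E <= H%:E)
  (HK : \int[leb]_x (`|p x - phi x| * f x ^+ 2)%:E <= K%:E)
  (HM : \int[Pr]_w \int[leb]_x ((qN w x - p x) ^+ 2)%:E <= (m ^+ 2)%:E).

(** Integrating the pointwise bound costs the mean integrated squared error
    divided by [delta m], plus [m / delta]: with [m ^ 2] of the order of the
    former, both are of order [m / delta]. *)
Lemma second_moment_excess :
  \int[Pr]_w \int[leb]_x ((p x * f x) ^+ 2 / q w x)%:E <=
    (V + (1 + H + K) * (m / delta + delta / (1 - delta)))%:E.
Proof.
have [d0 d1] := andP delta01.
have d0' := ltW d0; have m0' := ltW m_gt0.
have d1' : (0 < 1 - delta)%R by rewrite subr_gt0.
have q_gt0 w x : (0 < q w x)%R.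
  by rewrite qE ltr_wpDl ?mulr_gt0//; apply: mulr_ge0 => //; exact: ltW.
have f2 x : (0 <= f x ^+ 2)%R by rewrite sqr_ge0.
have mf2 : measurable_fun [set: T] (fun x => (f x ^+ 2)%R) by exact: measurable_funX.
have mA : measurable_fun [set: T] (fun x => (p x * f x ^+ 2)%:E).
  by apply/measurable_EFinP; exact: measurable_funM.
have mB : measurable_fun [set: T] (fun x => ((p x * f x ^+ 2 / phi x) ^+ 2)%:E).
  apply/measurable_EFinP; apply: measurable_funX; apply: measurable_funM.
    exact: measurable_funM.
  exact: measurable_fun_inv_gt0.
have mC : measurable_fun [set: T] (fun x => (`|p x - phi x| * f x ^+ 2)%:E).
  apply/measurable_EFinP; apply: measurable_funM => //.
  by apply: measurableT_comp => //; exact: measurable_funB.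
have mG : measurable_fun [set: Omega * T] (fun z => ((qN z.1 z.2 - p z.2) ^+ 2)%:E).
  apply/measurable_EFinP; apply: measurable_funX; apply: measurable_funB => //.
  exact: (measurableT_comp mp measurable_snd).
have mL : measurable_fun [set: Omega * T] (fun z => ((p z.2 * f z.2) ^+ 2 / q z.1 z.2)%:E).
  apply/measurable_EFinP; apply: measurable_funM.
    apply: measurable_funX; apply: measurable_funM.
      exact: (measurableT_comp mp measurable_snd).
    exact: (measurableT_comp mf measurable_snd).
  exact: (@measurable_fun_inv_gt0 _ _ _ (fun z : Omega * T => q z.1 z.2)).
have mGw w : measurable_fun [set: T] (fun x => ((qN w x - p x) ^+ 2)%:E).
  exact: (measurable_fun_pair2 w mG).
have mLw w : measurable_fun [set: T] (fun x => ((p x * f x) ^+ 2 / q w x)%:E).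
  exact: (measurable_fun_pair2 w mL).
have A0 x : 0 <= (p x * f x ^+ 2)%:E by rewrite lee_fin mulr_ge0// ltW.
have B0 x : 0 <= ((p x * f x ^+ 2 / phi x) ^+ 2)%:E by rewrite lee_fin sqr_ge0.
have C0 x : 0 <= (`|p x - phi x| * f x ^+ 2)%:E by rewrite lee_fin mulr_ge0.
have G0 w x : 0 <= ((qN w x - p x) ^+ 2)%:E by rewrite lee_fin sqr_ge0.
have cB : (0 <= m / (2 * delta))%R by rewrite divr_ge0// mulr_ge0.
have cG : (0 <= (2 * delta * m)^-1)%R by rewrite invr_ge0 !mulr_ge0.
have cC : (0 <= delta / (1 - delta))%R by rewrite divr_ge0// ltW.
pose G w := \int[leb]_x ((qN w x - p x) ^+ 2)%:E.
have mGint : measurable_fun [set: Omega] G.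
  exact: (@measurable_fun_fubini_tonelli_F _ _ _ _ _ leb
    (fun z => ((qN z.1 z.2 - p z.2) ^+ 2)%:E)).
have G0' w : 0 <= G w by apply: integral_ge0 => x _; exact: G0.
pose c0 := (V + (m / (2 * delta) * H + delta / (1 - delta) * K))%R.
have inner w : \int[leb]_x ((p x * f x) ^+ 2 / q w x)%:E <=
    (2 * delta * m)^-1%:E * G w + c0%:E.
  apply: (@le_trans _ _ (\int[leb]_x ((2 * delta * m)^-1%:E * ((qN w x - p x) ^+ 2)%:E +
      ((m / (2 * delta))%:E * ((p x * f x ^+ 2 / phi x) ^+ 2)%:E +
      ((delta / (1 - delta))%:E * (`|p x - phi x| * f x ^+ 2)%:E +
        (p x * f x ^+ 2)%:E))))).
    apply: ge0_le_integral => //.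
    - by move=> x _; rewrite lee_fin divr_ge0 ?sqr_ge0// ltW.
    - by repeat (apply: emeasurable_funD || apply: emeasurable_funM) => //;
        exact: measurable_cst.
    move=> x _; rewrite -!EFinM -!EFinD lee_fin.
    apply: le_trans (@second_moment_integrand_bound _ (p x) (phi x) (qN w x) (q w x)
      (f x) delta m _ _ _ _ _ _) _ => //.
    by rewrite le_eqVlt; apply/orP; left; apply/eqP; ring.
  have mBB : measurable_fun [set: T] (fun x => (delta / (1 - delta))%:E *
      (`|p x - phi x| * f x ^+ 2)%:E + (p x * f x ^+ 2)%:E).
    by apply: emeasurable_funD => //; apply: emeasurable_funM => //; exact: measurable_cst.
  rewrite ge0_integral_affine//; last 2 first.
  - by apply: emeasurable_funD => //; apply: emeasurable_funM => //; exact: measurable_cst.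
  - by move=> x; rewrite !adde_ge0 ?mule_ge0// lee_fin.
  rewrite leeD2l//.
  rewrite ge0_integral_affine//; last first.
  - by move=> x; rewrite !adde_ge0 ?mule_ge0// lee_fin.
  rewrite ge0_integral_affine//.
  have -> : c0%:E = (m / (2 * delta))%:E * H%:E +
      ((delta / (1 - delta))%:E * K%:E + V%:E).
    by rewrite -!EFinM -!EFinD /c0; congr EFin; ring.
  by rewrite !leeD// lee_wpmul2l ?lee_fin.
have V0 : (0 <= V)%R by rewrite -lee_fin (le_trans _ HV)// integral_ge0.
have H0 : (0 <= H)%R by rewrite -lee_fin (le_trans _ HH)// integral_ge0.
have K0 : (0 <= K)%R by rewrite -lee_fin (le_trans _ HK)// integral_ge0.
have c00 : (0 <= c0)%R.
  by rewrite addr_ge0// addr_ge0// mulr_ge0.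
apply: (@le_trans _ _ (\int[Pr]_w ((2 * delta * m)^-1%:E * G w + c0%:E))).
  apply: ge0_le_integral => //.
  - by move=> w _; apply: integral_ge0 => x _; rewrite lee_fin divr_ge0 ?sqr_ge0// ltW.
  - apply: (@measurable_fun_fubini_tonelli_F _ _ _ _ _ leb
      (fun z => ((p z.2 * f z.2) ^+ 2 / q z.1 z.2)%:E)) => // z.
    by rewrite lee_fin divr_ge0 ?sqr_ge0// ltW.
  - by apply: emeasurable_funD => //; apply: emeasurable_funM => //; exact: measurable_cst.
rewrite ge0_integral_affine//.
rewrite integral_cst_probability.
apply: (@le_trans _ _ ((2 * delta * m)^-1%:E * (m ^+ 2)%:E + c0%:E)).
  by rewrite leeD2r// lee_wpmul2l ?lee_fin.
rewrite -EFinM -EFinD lee_fin /c0.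
rewrite -subr_ge0.
set A := (m / delta)%R; set B := (delta / (1 - delta))%R.
have A0' : (0 <= A)%R by rewrite divr_ge0.
rewrite (_ : (_ - _)%R = (A * (1 + H) / 2 + A * K + B * (1 + H))%R); last first.
  by rewrite /A; field; rewrite !gt_eqF.
have H1 : (0 <= 1 + H)%R by rewrite addr_ge0.
have B0' : (0 <= B)%R by exact: cC.
have AH : (0 <= A * (1 + H))%R by exact: mulr_ge0.
have AK : (0 <= A * K)%R by exact: mulr_ge0.
have BH : (0 <= B * (1 + H))%R by exact: mulr_ge0.
by lra.
Qed.

End excess.

(** * Errors of ratios of averages *)

Section ratio_bounds.
Context {R : realType}.
Implicit Types A B mu t lam : R.

(** Subtracting and adding [mu] in the numerator gives [A / B' - mu = (A - mu)
    + ((A - mu) + mu) (1 - B') / B'], and truncating [B] at [t <= 1] can only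
    bring it closer to 1. *)
Lemma truncated_ratio_error A B mu t : 0 < t -> t <= 1 ->
  `|A / Num.max t B - mu| <=
    `|A - mu| + t^-1 * (`|A - mu| * `|B - 1| + `|mu| * `|B - 1|).
Proof.
move=> t0 t1; set B' := Num.max t B.
have B't : t <= B' by rewrite le_max lexx.
have B'0 : 0 < B' := lt_le_trans t0 B't.
have B'1 : `|B' - 1| <= `|B - 1|.
  rewrite /B'; case: (leP B t) => [Bt|//].
  rewrite !ler0_norm ?subr_le0 ?(le_trans Bt)//; lra.
have -> : A / B' - mu = (A - mu) + ((A - mu) + mu) * (1 - B') / B'.
  by field; rewrite gt_eqF.
apply: (le_trans (ler_normD _ _)); rewrite lerD2l -mulrDl !normrM mulrC.
rewrite (distrC 1) normfV (gtr0_norm B'0).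
apply: ler_pM; rewrite ?invr_ge0 ?mulr_ge0 ?(ltW B'0)//.
- by rewrite lef_pV2.
- by apply: ler_pM => //; exact: ler_normD.
Qed.

(** Each value is at most [lam], or else at most its own fourth power over
    [lam ^ 3]; a weighted mean cannot exceed a common bound of the values. *)
Lemma weighted_mean_le n (w f : 'I_n -> R) lam : 0 < lam -> (0 < n)%N ->
  (forall i, 0 < w i) ->
  `|(\sum_(i < n) w i * f i) / \sum_(i < n) w i| <=
    lam + lam ^- 3 * \sum_(i < n) f i ^+ 4.
Proof.
move=> lam0 n0 w0.
have W0 : 0 < \sum_(i < n) w i.
  rewrite (bigD1 (Ordinal n0))//= ltr_wpDr// sumr_ge0// => i _.
  exact: ltW.
have f4 i : 0 <= f i ^+ 4 by rewrite exprn_even_ge0.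
have lam3 : 0 <= lam ^- 3 by rewrite invr_ge0 exprn_ge0// ltW.
rewrite normrM normfV (gtr0_norm W0) ler_pdivrMr// mulr_sumr.
apply: (le_trans (ler_norm_sum _ _ _)); apply: ler_sum => i _.
rewrite normrM (gtr0_norm (w0 i)) mulrC ler_wpM2r ?(ltW (w0 i))//.
apply: (@le_trans _ _ (lam + lam ^- 3 * f i ^+ 4)); last first.
  rewrite lerD2l; apply: ler_wpM2l => //.
  by rewrite (bigD1 i)//= lerDl sumr_ge0.
have [fl|lf] := leP `|f i| lam.
  by apply: (le_trans fl); rewrite lerDl; exact: mulr_ge0.
apply: (@le_trans _ _ (lam ^- 3 * f i ^+ 4)); last by rewrite lerDr ltW.
have -> : f i ^+ 4 = `|f i| ^+ 3 * `|f i|.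
  by rewrite -exprSr -normrX ger0_norm.
rewrite mulrA; apply: ler_peMl => //; rewrite -exprVn -exprMn exprn_ege1//.
by rewrite mulrC ler_pdivlMr// mul1r ltW.
Qed.

(** When the denominator is below 1/2, truncation is no longer harmless, but
    then [4 (B - 1) ^ 2 >= 1], and the ratio is a weighted mean of the values
    of [f]. The parameter [lam] balances the fourth moment of [f] against the
    probability of this event. *)
Lemma ratio_error n (w f : 'I_n -> R) (A B mu lam : R) : 0 < lam -> (0 < n)%N ->
  (forall i, 0 < w i) ->
  A = n%:R^-1 * \sum_(i < n) w i * f i -> B = n%:R^-1 * \sum_(i < n) w i ->
  `|A / B - mu| <= (`|A - mu| + 2 * (`|A - mu| * `|B - 1| + `|mu| * `|B - 1|))
    + (lam ^- 3 * \sum_(i < n) f i ^+ 4 + 4 * lam * (B - 1) ^+ 2).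
Proof.
move=> lam0 n0 w0 AE BE.
have f4 : 0 <= lam ^- 3 * \sum_(i < n) f i ^+ 4.
  rewrite mulr_ge0 ?invr_ge0 ?exprn_ge0 ?(ltW lam0)// sumr_ge0// => i _.
  by rewrite exprn_even_ge0.
have [Bhalf|Bhalf] := leP 2^-1 B.
  have half0 : (0 : R) < 2^-1 by rewrite invr_gt0.
  have half1 : (2^-1 : R) <= 1 by rewrite invf_le1 ?ler1n.
  have := truncated_ratio_error A B mu half0 half1; rewrite max_r// invrK.
  move=> /le_trans; apply; rewrite lerDl; apply: addr_ge0 => //.
  by apply: mulr_ge0; [apply: mulr_ge0 => //; exact: ltW|exact: sqr_ge0].
have B1 : 2^-1 <= `|B - 1| by rewrite ler0_norm; lra.
have AB : `|A / B| <= lam + lam ^- 3 * \sum_(i < n) f i ^+ 4.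
  rewrite AE BE -mulf_div divff ?mul1r ?invr_eq0 ?pnatr_eq0 -?lt0n//.
  exact: weighted_mean_le.
apply: (le_trans (ler_normB _ _)).
have l1 : lam <= 4 * lam * (B - 1) ^+ 2.
  have D1 : 1 <= 4 * (B - 1) ^+ 2 by nra.
  by rewrite mulrAC mulrC; apply: ler_peMr => //; exact: ltW.
have l2 : `|mu| <= 2 * (`|mu| * `|B - 1|).
  by have := normr_ge0 mu; nra.
have l3 : 0 <= `|A - mu| * `|B - 1| by rewrite mulr_ge0.
have l4 := normr_ge0 (A - mu).
by lra.
Qed.

End ratio_bounds.

Section expectation_bounds.
Context {R : realType} {d} {Omega : measurableType d} (Pr : probability Omega R).
Implicit Types U V A B : Omega -> R.

Lemma expectation_ge0_le U V : measurable_fun [set: Omega] U ->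
  measurable_fun [set: Omega] V -> (forall w, 0 <= U w) ->
  (forall w, U w <= V w) -> ('E_Pr[U] <= 'E_Pr[V])%E.
Proof.
move=> mU mV U0 UV; rewrite unlock; apply: ge0_le_integral => //.
- by move=> w _; rewrite lee_fin.
- exact/measurable_EFinP.
- exact/measurable_EFinP.
- by move=> w _; rewrite lee_fin.
Qed.

Lemma expectation_ge0_linear U V (a b : R) : measurable_fun [set: Omega] U ->
  measurable_fun [set: Omega] V -> (forall w, 0 <= U w) -> (forall w, 0 <= V w) ->
  0 <= a -> 0 <= b ->
  ('E_Pr[fun w => (a * U w + b * V w)%R] = a%:E * 'E_Pr[U] + b%:E * 'E_Pr[V])%E.
Proof.
move=> mU mV U0 V0 a0 b0; rewrite unlock.
have mUE : measurable_fun [set: Omega] (EFin \o U) by exact/measurable_EFinP.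
have mVE : measurable_fun [set: Omega] (EFin \o V) by exact/measurable_EFinP.
have VE0 x : (0 <= (EFin \o V) x)%E by rewrite lee_fin.
have UE0 x : (0 <= (EFin \o U) x)%E by rewrite lee_fin.
rewrite -(ge0_integralZl Pr measurableT mVE) ?lee_fin//.
rewrite -(ge0_integral_affine Pr mUE)//.
- by apply: emeasurable_funM => //; exact: measurable_cst.
- by move=> x; rewrite mule_ge0.
Qed.

(** Cauchy-Schwarz, through the inequality between arithmetic and geometric
    means with weights chosen from the known bounds. *)
Lemma expectation_mul_le U V (a b : R) : 0 < a -> 0 < b ->
  measurable_fun [set: Omega] U -> measurable_fun [set: Omega] V ->
  ('E_Pr[fun w => (U w ^+ 2)%R] <= (a ^+ 2)%:E)%E ->
  ('E_Pr[fun w => (V w ^+ 2)%R] <= (b ^+ 2)%:E)%E ->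
  ('E_Pr[fun w => (`|U w| * `|V w|)%R] <= (a * b)%:E)%E.
Proof.
move=> a0 b0 mU mV Ua Vb.
have ab0 : 0 <= b / (2 * a) by rewrite ltW// divr_gt0// mulr_gt0.
have ba0 : 0 <= a / (2 * b) by rewrite ltW// divr_gt0// mulr_gt0.
have mU2 : measurable_fun [set: Omega] (fun w => U w ^+ 2) by exact: measurable_funX.
have mV2 : measurable_fun [set: Omega] (fun w => V w ^+ 2) by exact: measurable_funX.
apply: (@le_trans _ _
    'E_Pr[fun w => (b / (2 * a) * U w ^+ 2 + a / (2 * b) * V w ^+ 2)%R])%E.
  apply: expectation_ge0_le.
  - by apply: measurable_funM; exact: measurableT_comp.
  - by apply: measurable_funD; exact: measurable_funM.
  - by move=> w; rewrite mulr_ge0.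
  move=> w; rewrite -(real_normK (num_real (U w))) -(real_normK (num_real (V w))).
  rewrite -subr_ge0 [X in 0 <= X](_ : _ =
    (2 * a * b)^-1 * (b * `|U w| - a * `|V w|) ^+ 2); last first.
    by field; rewrite !gt_eqF.
  by rewrite mulr_ge0 ?sqr_ge0// invr_ge0 !mulr_ge0// ltW.
rewrite expectation_ge0_linear//; last 2 first.
- by move=> w; rewrite sqr_ge0.
- by move=> w; rewrite sqr_ge0.
apply: (@le_trans _ _
    ((b / (2 * a))%:E * (a ^+ 2)%:E + (a / (2 * b))%:E * (b ^+ 2)%:E)%E).
  by apply: leeD; apply: lee_wpmul2l; rewrite ?lee_fin.
rewrite -!EFinM -EFinD lee_fin le_eqVlt; apply/orP; left; apply/eqP.
by field; rewrite !gt_eqF.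
Qed.

Lemma expectation_norm_le U (a : R) : 0 < a -> measurable_fun [set: Omega] U ->
  ('E_Pr[fun w => (U w ^+ 2)%R] <= (a ^+ 2)%:E)%E ->
  ('E_Pr[fun w => (`|U w|)%R] <= a%:E)%E.
Proof.
move=> a0 mU Ua; rewrite -[a]mulr1.
have -> : (fun w => `|U w|) = (fun w => `|U w| * `|(cst 1 : Omega -> R) w|).
  by apply/funext => w; rewrite /= normr1 mulr1.
apply: expectation_mul_le => //.
rewrite (_ : (fun w => _) = cst 1); first by rewrite expectation_cst expr1n.
by apply/funext => w; rewrite /= expr1n.
Qed.

Lemma expectation_deviation A B (mu a b t : R) : 0 < a -> 0 < b -> 0 <= t ->
  measurable_fun [set: Omega] A -> measurable_fun [set: Omega] B ->
  ('E_Pr[fun w => ((A w - mu) ^+ 2)%R] <= (a ^+ 2)%:E)%E ->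
  ('E_Pr[fun w => ((B w - 1) ^+ 2)%R] <= (b ^+ 2)%:E)%E ->
  ('E_Pr[fun w => (`|A w - mu| + t * (`|A w - mu| * `|B w - 1| + `|mu| * `|B w - 1|))%R]
    <= (a + t * (a * b + `|mu| * b))%:E)%E.
Proof.
move=> a0 b0 t0 mA mB Aa Bb.
have mA' : measurable_fun [set: Omega] (fun w => A w - mu) by exact: measurable_funB.
have mB' : measurable_fun [set: Omega] (fun w => B w - 1) by exact: measurable_funB.
have mnA : measurable_fun [set: Omega] (fun w => `|A w - mu|).
  exact: measurableT_comp.
have mnB : measurable_fun [set: Omega] (fun w => `|B w - 1|).
  exact: measurableT_comp.
have mnAB : measurable_fun [set: Omega] (fun w => `|A w - mu| * `|B w - 1|).
  exact: measurable_funM.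
have -> : (fun w => `|A w - mu| + t * (`|A w - mu| * `|B w - 1| + `|mu| * `|B w - 1|)) =
    (fun w => 1 * `|A w - mu| + t *
       (1 * (`|A w - mu| * `|B w - 1|) + `|mu| * `|B w - 1|)).
  by apply/funext => w; rewrite !mul1r.
have mV : measurable_fun [set: Omega]
    (fun w => 1 * (`|A w - mu| * `|B w - 1|) + `|mu| * `|B w - 1|).
  by apply: measurable_funD; exact: measurable_funM.
have V0 w : 0 <= 1 * (`|A w - mu| * `|B w - 1|) + `|mu| * `|B w - 1|.
  by rewrite mul1r addr_ge0// mulr_ge0.
have AB0 w : 0 <= `|A w - mu| * `|B w - 1| by rewrite mulr_ge0.
rewrite (expectation_ge0_linear mnA mV)//.
rewrite (expectation_ge0_linear mnAB mnB)//.
rewrite !mul1e EFinD; apply: leeD; first exact: expectation_norm_le mA' Aa.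
rewrite EFinM; apply: lee_wpmul2l; rewrite ?lee_fin// EFinD.
apply: leeD; first exact: expectation_mul_le mA' mB' Aa Bb.
by rewrite EFinM; apply: lee_wpmul2l; rewrite ?lee_fin//; exact: expectation_norm_le.
Qed.

End expectation_bounds.

(** * Integration against a density *)

Section density_facts.
Context {R : realType} {dO dT : measure_display} {Omega : measurableType dO}
  {T : measurableType dT} (mu : {measure set Omega -> \bar R})
  (leb : {measure set T -> \bar R}) (Z : Omega -> T) (p : T -> R).
Hypotheses (mZ : measurable_fun [set: Omega] Z) (mp : measurable_fun [set: T] p)
  (p_ge0 : forall x, 0 <= p x)
  (Z_p : forall A, measurable A ->
    mu (Z @^-1` A) = (\int[leb]_(x in A) (p x)%:E)%E).
Local Open Scope ereal_scope.

Lemma integral_law_density (u : T -> \bar R) :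
  measurable_fun [set: T] u -> (forall x, 0 <= u x) ->
  \int[mu]_w u (Z w) = \int[leb]_x (u x * (p x)%:E).
Proof.
move=> mu' u0.
have := @integral_weighted_transfer _ _ _ _ _ _ _ mu leb Z id (fun=> 1%R) p
  mZ (@measurable_id _ _ _) (@measurable_cst _ _ _ _ _ _) mp _ p_ge0 u.
move=> <-//; first by apply: eq_integral => w _; rewrite mule1.
move=> E mE; rewrite integral_cst//; first by rewrite mul1e Z_p.
by rewrite -[X in measurable X]setTI; exact: mZ.
Qed.

Lemma integral_law_density_fine (f : T -> R) (a : R) : measurable_fun [set: T] f ->
  \int[leb]_x (f x * p x)%:E = a%:E -> \int[mu]_w (f (Z w))%:E = a%:E.
Proof.
move=> mf <-; rewrite [RHS]integralE [LHS]integralE.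
have mfE : measurable_fun [set: T] (EFin \o f) by exact/measurable_EFinP.
have part (u : T -> \bar R) (v : Omega -> \bar R) (h : T -> \bar R) :
    measurable_fun [set: T] u -> (forall x, 0 <= u x) -> (forall w, v w = u (Z w)) ->
    (forall x, h x = u x * (p x)%:E) -> \int[mu]_w v w = \int[leb]_x h x.
  move=> mu' u0 vE hE; rewrite (eq_integral (fun w => u (Z w))) => [|w _]; last exact: vE.
  by rewrite integral_law_density//; apply: eq_integral => x _; rewrite hE.
congr (_ - _).
- apply: (part (EFin \o f)^\+) => //; first exact: measurable_funepos.
    by move=> w; rewrite !funeposE.
  move=> x; rewrite !funeposE -[(EFin \o f) x]/(f x)%:E.
  by rewrite maxe_pMl ?lee_fin// mul0e -EFinM.
- apply: (part (EFin \o f)^\-) => //; first exact: measurable_funeneg.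
    by move=> w; rewrite !funenegE.
  move=> x; rewrite !funenegE -[(EFin \o f) x]/(f x)%:E.
  by rewrite maxe_pMl ?lee_fin// mul0e mulNe -EFinM.
Qed.
End density_facts.

Lemma has_density_integral {R : realType} (d : nat)
    (P : {measure set (d.-tuple R) -> \bar R}) (p : d.-tuple R -> R)
    (u : d.-tuple R -> \bar R) :
  is_pdf p -> has_density P p -> measurable_fun [set: d.-tuple R] u ->
  (forall x, (0 <= u x)%E) ->
  (\int[P]_x u x = \int[lebesgueRd d]_x (u x * (p x)%:E))%E.
Proof.
move=> [mp p0 _] Pp mu u0.
by rewrite (integral_law_density (mu := P) (leb := lebesgueRd d) (Z := id) (p := p)).
Qed.

Section target.
Context {R : realType} (d : nat) (P : probability (d.-tuple R) R).
Variables (p f phi : d.-tuple R -> R).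
Hypotheses (p_pdf : is_pdf p) (P_p : has_density P p) (f_L2 : f \in Lfun P 2%:E).
Local Notation leb := (lebesgueRd d).
Local Open Scope ereal_scope.

Let mp : measurable_fun [set: d.-tuple R] p. Proof. by case: p_pdf. Qed.
Let p0 x : (0 <= p x)%R. Proof. by case: p_pdf. Qed.
Let mf : measurable_fun [set: d.-tuple R] f.
Proof. by move: f_L2; rewrite inE => /andP[]; rewrite inE. Qed.

Lemma target_second_moment : \int[leb]_x (p x * f x ^+ 2)%:E < +oo.
Proof.
have /integrableP[mf2 f2] := Lfun2_integrable_sqr f_L2.
rewrite (eq_integral (fun x => (f x ^+ 2)%:E * (p x)%:E)); last first.
  by move=> x _; rewrite -EFinM mulrC.
rewrite -(has_density_integral p_pdf P_p mf2) => [|x]; last by rewrite lee_fin sqr_ge0.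
apply: le_lt_trans f2; rewrite le_eqVlt; apply/orP; left; apply/eqP.
by apply: eq_integral => x _; rewrite /= ger0_norm// sqr_ge0.
Qed.

(** Since [|f| <= 1 + f ^ 2]. *)
Lemma target_integrable : leb.-integrable [set: d.-tuple R] (EFin \o (fun x => p x * f x)%R).
Proof.
apply/integrableP; split.
  by apply/measurable_EFinP; exact: measurable_funM.
have p1 : \int[leb]_x (p x)%:E = 1 by case: p_pdf.
apply: (@le_lt_trans _ _ (\int[leb]_x ((p x)%:E + (p x * f x ^+ 2)%:E))).
  apply: ge0_le_integral => //.
  - by apply: measurableT_comp => //; apply/measurable_EFinP; exact: measurable_funM.
  - apply: emeasurable_funD; apply/measurable_EFinP => //.
    by apply: measurable_funM => //; exact: measurable_funX.
  move=> x _; rewrite /= -EFinD lee_fin normrM (ger0_norm (p0 x)).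
  rewrite -[X in (_ <= X + _)%R]mulr1 -mulrDr ler_wpM2l//.
  by rewrite -(real_normK (num_real (f x))); have := normr_ge0 (f x); nra.
rewrite ge0_integralD//; last 4 first.
- by move=> x _; rewrite lee_fin.
- exact/measurable_EFinP.
- by move=> x _; rewrite lee_fin mulr_ge0// sqr_ge0.
- by apply/measurable_EFinP; apply: measurable_funM => //; exact: measurable_funX.
by rewrite p1 lte_add_pinfty// ?ltry//; exact: target_second_moment.
Qed.

Lemma variance_of_target {dO} {Omega : measurableType dO} (Pr : probability Omega R)
    (Z : {RV Pr >-> d.-tuple R}) (V I : R) :
  (forall A, measurable A -> distribution Pr Z A = P A) ->
  \int[leb]_x (p x * f x ^+ 2)%:E = V%:E -> \int[leb]_x (f x * p x)%:E = I%:E ->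
  'V_Pr[f \o Z] = (V - I ^+ 2)%:E.
Proof.
move=> Z_P fV fI.
have mZ : measurable_fun [set: Omega] Z by [].
have Zp A : measurable A -> Pr (Z @^-1` A) = \int[leb]_(x in A) (p x)%:E.
  by move=> mA; rewrite -(P_p mA) -Z_P.
have mfZ : measurable_fun [set: Omega] (f \o Z) by exact: measurableT_comp.
have EfZ2 : \int[Pr]_w ((f \o Z) w ^+ 2)%:E = V%:E.
  rewrite -fV (eq_integral (fun w => (EFin \o (fun x => (f x ^+ 2)%R)) (Z w)))//.
  rewrite (integral_law_density (u := EFin \o (fun x => (f x ^+ 2)%R)) mZ mp p0 Zp)//.
  - by apply: eq_integral => x _; rewrite /= mulrC.
  - by apply/measurable_EFinP; exact: measurable_funX.
  - by move=> x; rewrite lee_fin sqr_ge0.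
rewrite varianceE; last first.
  by apply: Lfun2_sqr_integral => //; rewrite EfZ2 ltry.
have -> : 'E_Pr[f \o Z] = I%:E.
  by rewrite unlock (integral_law_density_fine mZ mp p0 Zp mf fI).
by rewrite unlock EfZ2 -EFin_expe EFinB.
Qed.

(** One factor [p] comes from the measure [P], the other from the square of
    [Num.sqrt (p x)]. *)
Lemma defensive_constant (h phi' : d.-tuple R -> R) :
  measurable_fun [set: d.-tuple R] h ->
  measurable_fun [set: d.-tuple R] phi' -> (forall x, (0 < phi' x)%R) ->
  'N[P]_2%:E[(fun x => (h x * Num.sqrt (p x) / phi' x)%:E)] < +oo ->
  \int[leb]_x ((p x * h x / phi' x) ^+ 2)%:E < +oo.
Proof.
move=> mh mphi phi0 hfin; set g := fun x => (h x * Num.sqrt (p x) / phi' x)%R.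
have msqrt : measurable_fun [set: d.-tuple R] (fun x => Num.sqrt (p x)).
  apply: (measurableT_comp _ mp); apply: continuous_measurable_fun.
  exact: sqrt_continuous.
have mg : measurable_fun [set: d.-tuple R] g.
  apply: measurable_funM; first exact: measurable_funM.
  exact: measurable_fun_inv_gt0.
have : \int[P]_x (g x ^+ 2)%:E < +oo.
  by rewrite -(Lnorm_even_power P (k := 2))//; exact: poweR_lty.
rewrite (has_density_integral p_pdf P_p) => [||x]; last 2 first.
- by apply/measurable_EFinP; exact: measurable_funX.
- by rewrite lee_fin sqr_ge0.
apply: le_lt_trans; rewrite le_eqVlt; apply/orP; left; apply/eqP.
apply: eq_integral => x _; rewrite -EFinM; congr EFin; rewrite /g.
by rewrite !exprMn sqr_sqrtr//; ring.
Qed.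

End target.

(** * Error bounds for one proposal *)

Section self_normalised.
Context {R : realType} (d n : nat).
Variables (p pt q f : d.-tuple R -> R) (c : R) (x : 'I_n -> d.-tuple R).
Hypotheses (c_gt0 : 0 < c) (n_gt0 : (0 < n)%N) (ptE : forall y, pt y = c * p y).

Let A : R := IS p q f x.
Let B : R := IS p q (cst 1) x.

Let n_neq0 : n%:R != 0 :> R. Proof. by rewrite pnatr_eq0 -lt0n. Qed.

Let numE : \sum_(i < n) pt (x i) * f (x i) / q (x i) = c * n%:R * A.
Proof.
rewrite /A /IS mulrA mulfK// mulr_sumr; apply: eq_bigr => i _.
by rewrite ptE -!mulrA.
Qed.

Let denE : \sum_(i < n) pt (x i) / q (x i) = c * n%:R * B.
Proof.
rewrite /B /IS mulrA mulfK// mulr_sumr; apply: eq_bigr => i _.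
by rewrite /= mulr1 ptE -!mulrA.
Qed.

Let cn_gt0 : 0 < c * n%:R. Proof. by rewrite mulr_gt0// ltr0n. Qed.

Lemma SNIS_ratio : SNIS pt q f x = A / B.
Proof. by rewrite /SNIS numE denE -mulf_div divff ?mul1r// gt_eqF. Qed.

Lemma SNIS_trunc_ratio tau : SNIS_trunc tau pt q f x = A / Num.max (tau / c) B.
Proof.
rewrite /SNIS_trunc numE denE.
have -> : tau * n%:R = c * n%:R * (tau / c) by field; rewrite gt_eqF.
by rewrite -maxr_pMr ?ltW// -mulf_div divff ?mul1r// gt_eqF.
Qed.

End self_normalised.

Section fixed_proposal.
Context {R : realType} {dO : measure_display} {Omega : measurableType dO}
  (Pr : probability Omega R) (d : nat).
Variables (p phi : d.-tuple R -> R) (delta m : R) (qN q : Omega -> d.-tuple R -> R)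
  (Q : Omega -> pprobability (d.-tuple R) R).
Local Notation leb := (lebesgueRd d).
Hypotheses (p_pdf : is_pdf p) (p_gt0 : forall x, 0 < p x)
  (phi_pdf : is_pdf phi) (phi_gt0 : forall x, 0 < phi x)
  (delta01 : 0 < delta < 1) (qN_pdf : forall w, is_pdf (qN w))
  (qE : forall w, q w = defensive delta (qN w) phi)
  (Q_q : forall w, has_density (Q w) (q w)) (q_meas : measurable_given Q q)
  (Q_sub : g_sigma_algebra_preimage Q `<=` @measurable _ Omega)
  (m_gt0 : 0 < m) (qN_MISE : (MISE Pr qN p <= (m ^+ 2)%:E)%E).
Variables (n : nat) (X : 'I_n -> {RV Pr >-> d.-tuple R}).
Hypotheses (n_gt0 : (0 < n)%N) (X_iid : cond_iid Pr Q X).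

Let mp : measurable_fun [set: d.-tuple R] p. Proof. by case: p_pdf. Qed.
Let mphi : measurable_fun [set: d.-tuple R] phi. Proof. by case: phi_pdf. Qed.
Let qN_ge0 w x : 0 <= qN w x. Proof. by case: (qN_pdf w). Qed.
Let mX i : measurable_fun [set: Omega] (X i). Proof. by []. Qed.

Lemma proposal_gt0 w x : 0 < q w x.
Proof.
have [d0 d1] := andP delta01.
by rewrite qE /defensive ltr_wpDl ?mulr_gt0// mulr_ge0// subr_ge0 ltW.
Qed.

Let mq : measurable_fun [set: Omega * d.-tuple R] (fun z => q z.1 z.2).
Proof. exact: (measurableT_comp q_meas (measurable_forget_pair Q_sub)). Qed.

Let mqN : measurable_fun [set: Omega * d.-tuple R] (fun z => qN z.1 z.2).
Proof.
have [d0 d1] := andP delta01.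
rewrite (_ : (fun z => _) =
    (fun z => (1 - delta)^-1 * (q z.1 z.2 - delta * phi z.2))).
  apply: measurable_funM => //; apply: measurable_funB => //.
  by apply: measurable_funM => //; exact: (measurableT_comp mphi measurable_snd).
apply/funext => z; rewrite qE /defensive addrK mulrA mulVf ?mul1r//.
by rewrite gt_eqF// subr_gt0.
Qed.

(** Order of the excess of the second moment: [m / delta] is paid for
    estimating the target, [delta / (1 - delta)] for mixing in the defensive
    density. *)
Definition excess_rate : R := m / delta + delta / (1 - delta).

Lemma weighted_average_deviation (f : d.-tuple R -> R) (V H K mu : R) :
  measurable_fun [set: d.-tuple R] f ->
  leb.-integrable [set: d.-tuple R] (EFin \o (fun x => p x * f x)) ->
  (\int[leb]_x (p x * f x)%:E = mu%:E)%E ->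
  (\int[leb]_x (p x * f x ^+ 2)%:E <= V%:E)%E ->
  (\int[leb]_x ((p x * f x ^+ 2 / phi x) ^+ 2)%:E <= H%:E)%E ->
  (\int[leb]_x (`|p x - phi x| * f x ^+ 2)%:E <= K%:E)%E ->
  ('E_Pr[fun w => ((IS p (q w) f (fun i => X i w) - mu) ^+ 2)%R] <=
    ((V + (1 + H + K) * excess_rate - mu ^+ 2) / n%:R)%:E)%E.
Proof.
move=> mf ipf pfmu HV HH HK.
apply: (@IS_mean_square _ _ _ _ _ Pr leb Q q Q_sub q_meas proposal_gt0 _ n X mX
  X_iid (fun x => p x * f x)) => //.
- exact: measurable_funM.
- apply: (second_moment_excess (qN := qN)) HV HH HK qN_MISE => //.
  by move=> w x; rewrite qE.
Qed.

Lemma measurable_IS (f : d.-tuple R -> R) : measurable_fun [set: d.-tuple R] f ->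
  measurable_fun [set: Omega] (fun w => IS p (q w) f (fun i => X i w)).
Proof.
move=> mf; apply: measurable_funM => //; apply: measurable_sum => i.
apply: (measurable_sampled_weight Q_sub q_meas proposal_gt0 mX (g := fun x => p x * f x)).
exact: measurable_funM.
Qed.

Section error_bounds.
Variables (f : d.-tuple R -> R) (I V sigma s rho H1 K1 H K : R).
Hypotheses (mf : measurable_fun [set: d.-tuple R] f)
  (pf_int : leb.-integrable [set: d.-tuple R] (EFin \o (fun x => p x * f x)))
  (pfI : (\int[leb]_x (p x * f x)%:E = I%:E)%E)
  (pfV : (\int[leb]_x (p x * f x ^+ 2)%:E <= V%:E)%E)
  (fH : (\int[leb]_x ((p x * f x ^+ 2 / phi x) ^+ 2)%:E <= H%:E)%E)
  (fK : (\int[leb]_x (`|p x - phi x| * f x ^+ 2)%:E <= K%:E)%E)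
  (oneH : (\int[leb]_x ((p x / phi x) ^+ 2)%:E <= H1%:E)%E)
  (oneK : (\int[leb]_x (`|p x - phi x|)%:E <= K1%:E)%E)
  (sigma_ge0 : 0 <= sigma) (sigmaE : V - I ^+ 2 = sigma ^+ 2)
  (s_gt0 : 0 < s) (s_f : 1 + H + K <= s ^+ 2) (s_one : 1 + H1 + K1 <= s ^+ 2)
  (rho_gt0 : 0 < rho) (rhoE : excess_rate = rho ^+ 2).

Local Notation A := (fun w => IS p (q w) f (fun i => X i w)).
Local Notation B := (fun w => IS p (q w) (cst 1) (fun i => X i w)).
Local Notation a' := (sigma + s * rho).
Local Notation b' := (s * rho).
Local Notation rn := ((Num.sqrt n%:R)^-1 : R).

Let b'_gt0 : 0 < b'. Proof. exact: mulr_gt0. Qed.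
Let a'_gt0 : 0 < a'. Proof. by rewrite ltr_wpDl. Qed.
Let sqrtn_gt0 : 0 < Num.sqrt n%:R :> R. Proof. by rewrite sqrtr_gt0 ltr0n. Qed.
Let rn_gt0 : 0 < rn. Proof. by rewrite invr_gt0. Qed.
Let rn_sqr : rn ^+ 2 = n%:R^-1.
Proof. by rewrite exprVn sqr_sqrtr// ler0n. Qed.
Let rn_le1 : rn <= 1.
Proof.
by rewrite invf_le1// -[leLHS]sqrtr1 ler_wsqrtr// ler1n.
Qed.
Let mA : measurable_fun [set: Omega] A. Proof. exact: measurable_IS. Qed.
Let mB : measurable_fun [set: Omega] B. Proof. exact: measurable_IS. Qed.

Lemma IS_mean_square_rate :
  ('E_Pr[fun w => ((A w - I) ^+ 2)%R] <= ((rn * a') ^+ 2)%:E)%E.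
Proof.
apply: (le_trans (weighted_average_deviation mf pf_int pfI pfV fH fK)).
rewrite lee_fin rhoE exprMn rn_sqr [leRHS]mulrC ler_wpM2r ?invr_ge0 ?ler0n//.
have excess_le : (1 + H + K) * rho ^+ 2 <= s ^+ 2 * rho ^+ 2.
  by rewrite ler_wpM2r// sqr_ge0.
have cross : 0 <= sigma * (s * rho) by rewrite mulr_ge0// ltW.
by rewrite sqrrD exprMn addrAC sigmaE -[leRHS]addrA lerD2l (le_trans excess_le)// lerDr mulrn_wge0.
Qed.

(** For the constant function 1 the target variance vanishes, so that only the
    excess remains. *)
Lemma IS_one_mean_square_rate :
  ('E_Pr[fun w => ((B w - 1) ^+ 2)%R] <= ((rn * b') ^+ 2)%:E)%E.
Proof.
have p1 : (\int[leb]_x (p x)%:E = 1)%E by case: p_pdf.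
have p1E : (\int[leb]_x (p x * 1)%:E = 1)%E.
  by rewrite -[RHS]p1; apply: eq_integral => x _; rewrite mulr1.
have ip : leb.-integrable [set: d.-tuple R] (EFin \o (fun x => p x * cst 1 x)).
  apply/integrableP; split.
    by apply/measurable_EFinP; exact: measurable_funM.
  under eq_integral => x _ do rewrite /= mulr1 gtr0_norm//.
  by rewrite p1 ltry.
have h := @weighted_average_deviation (cst 1) 1 H1 K1 1.
apply: le_trans (h _ ip _ _ _ _) _ => //.
- by rewrite -[leRHS]p1 le_eqVlt; apply/orP; left; apply/eqP;
    apply: eq_integral => x _; rewrite /= expr1n mulr1.
- apply: le_trans oneH; rewrite le_eqVlt; apply/orP; left; apply/eqP.
  by apply: eq_integral => x _; rewrite /= expr1n mulr1.
- apply: le_trans oneK; rewrite le_eqVlt; apply/orP; left; apply/eqP.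
  by apply: eq_integral => x _; rewrite /= expr1n mulr1.
rewrite lee_fin rhoE exprMn rn_sqr [leRHS]mulrC ler_wpM2r ?invr_ge0 ?ler0n//.
by rewrite expr1n addrAC subrr add0r exprMn ler_wpM2r// sqr_ge0.
Qed.

Lemma IS_error : ('E_Pr[fun w => `|A w - I|%R] <= rn%:E * (sigma%:E + b'%:E))%E.
Proof.
rewrite -EFinD -EFinM; apply: expectation_norm_le; first exact: mulr_gt0.
  exact: measurable_funB.
exact: IS_mean_square_rate.
Qed.

(** What remains of the error of a ratio, in units of [1 / sqrt n], once
    [sigma] has been taken out; [t] bounds the inverse of the denominator. *)
Definition ratio_remainder (t : R) : R := b' + t * (a' * b' + `|I| * b').

Lemma expectation_ratio_error t : 0 <= t ->
  ('E_Pr[fun w => (`|A w - I| + t * (`|A w - I| * `|B w - 1| + `|I| * `|B w - 1|))%R]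
    <= rn%:E * (sigma%:E + (ratio_remainder t)%:E))%E.
Proof.
move=> t0; apply: le_trans (expectation_deviation _ _ t0 mA mB
  IS_mean_square_rate IS_one_mean_square_rate) _; try exact: mulr_gt0.
rewrite -EFinD -EFinM lee_fin /ratio_remainder addrA [leRHS]mulrDr lerD2l.
rewrite [leRHS]mulrCA ler_wpM2l// [leRHS]mulrDr; apply: lerD; last by rewrite mulrCA.
rewrite mulrACA; apply: ler_wpM2r; first by rewrite ltW// mulr_gt0.
by apply: ler_piMr => //; exact: ltW.
Qed.

Lemma SNIS_trunc_error (c tau : R) (pt : d.-tuple R -> R) :
  0 < c -> 0 < tau -> tau < c -> (forall x, pt x = c * p x) ->
  ('E_Pr[fun w => `|SNIS_trunc tau pt (q w) f (fun i => X i w) - I|%R]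
    <= rn%:E * (sigma%:E + (ratio_remainder (tau / c)^-1)%:E))%E.
Proof.
move=> c0 tau0 tauc ptE.
have t0 : 0 < tau / c by rewrite divr_gt0.
have t1 : tau / c <= 1 by rewrite ler_pdivrMr// mul1r ltW.
have tV0 : 0 <= (tau / c)^-1 by rewrite invr_ge0 ltW.
apply: le_trans (expectation_ratio_error tV0).
under eq_fun do rewrite (SNIS_trunc_ratio _ _ _ c0 n_gt0 ptE).
apply: expectation_ge0_le => //.
- apply: measurableT_comp => //; apply: measurable_funB => //.
  apply: measurable_funM => //; apply: measurable_fun_inv_gt0.
    by move=> w; rewrite lt_max t0.
  exact: measurable_maxr.
- apply: measurable_funD; first by apply: measurableT_comp => //; exact: measurable_funB.
  apply: measurable_funM => //; apply: measurable_funD; apply: measurable_funM => //;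
    by apply: measurableT_comp => //; exact: measurable_funB.
- by move=> w; exact: truncated_ratio_error.
Qed.

(** Every sample has, on average over the proposal, the fourth moment of [f]
    under [Q]. *)
Lemma expectation_fourth_power (M : R) :
  (\int[Pr]_w ('N[Q w]_4%:E[EFin \o f] `^ 4) <= M%:E)%E ->
  ('E_Pr[fun w => (\sum_(i < n) f (X i w) ^+ 4)%R] <= (n%:R * M)%:E)%E.
Proof.
move=> fM.
have mf4 : measurable_fun [set: d.-tuple R] (EFin \o (fun x => f x ^+ 4)).
  by apply/measurable_EFinP; exact: measurable_funX.
have f40 x : 0 <= f x ^+ 4 by rewrite exprn_even_ge0.
have fourth i : (\int[Pr]_w (f (X i w) ^+ 4)%:E <= M%:E)%E.
  apply: le_trans fM; rewrite le_eqVlt; apply/orP; left; apply/eqP.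
  have mu : measurable_fun [set: g_sigma_algebra_preimageType Q * d.-tuple R]
      (fun z => (f z.2 ^+ 4)%:E).
    exact: (measurableT_comp mf4 measurable_snd).
  have q_ge0 w x : 0 <= q w x by rewrite ltW// proposal_gt0.
  rewrite (@integral_cond_law _ _ _ _ _ Pr leb Q q Q_sub q_meas q_ge0 Q_q
    (X i) (fun z => (f z.2 ^+ 4)%:E) (mX i) (X_iid.2 i) mu); last by move=> z; rewrite lee_fin f40.
  apply: eq_integral => w _; rewrite (Lnorm_even_power (Q w) (k := 4))//.
  have qw : is_pdf (q w).
    split => //; first exact: (measurable_fun_pair2 w mq).
    have := Q_q w measurableT; rewrite probability_setT => <-.
    by [].
  by rewrite (has_density_integral qw (Q_q w) mf4).
rewrite unlock; under eq_integral do rewrite -sumEFin.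
rewrite ge0_integral_sum//.
  apply: (le_trans (lee_sum _ (fun i _ => fourth i))).
  by rewrite sumEFin sumr_const card_ord mulr_natl.
- move=> i; apply/measurable_EFinP.
  exact: (measurableT_comp (measurable_funX 4 mf) (mX i)).
- by move=> i w _; rewrite lee_fin.
Qed.

Lemma SNIS_error (c M : R) (pt : d.-tuple R -> R) :
  0 < c -> (forall x, pt x = c * p x) ->
  (\int[Pr]_w ('N[Q w]_4%:E[EFin \o f] `^ 4) <= M%:E)%E ->
  ('E_Pr[fun w => `|SNIS pt (q w) f (fun i => X i w) - I|%R]
    <= rn%:E * (sigma%:E +
         (ratio_remainder 2 + (M * rho ^+ 3 + 4 * s ^+ 2 * rho))%:E))%E.
Proof.
move=> c0 ptE fM.
(* [n M / lam ^ 3] becomes [M rho ^ 3 / sqrt n], and [lam b' ^ 2 / n] becomes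
   [s ^ 2 rho / sqrt n] *)
set lam := Num.sqrt n%:R / rho.
have lam0 : 0 < lam by rewrite divr_gt0.
pose dev w := `|A w - I| + 2 * (`|A w - I| * `|B w - 1| + `|I| * `|B w - 1|).
pose F4 w := \sum_(i < n) f (X i w) ^+ 4.
pose D2 w := (B w - 1) ^+ 2.
pose rest w := lam ^- 3 * F4 w + 4 * lam * D2 w.
have mabsA : measurable_fun [set: Omega] (fun w => `|A w - I|).
  by apply: measurableT_comp => //; exact: measurable_funB.
have mabsB : measurable_fun [set: Omega] (fun w => `|B w - 1|).
  by apply: measurableT_comp => //; exact: measurable_funB.
have mdev : measurable_fun [set: Omega] dev.
  apply: measurable_funD => //; apply: measurable_funM => //.
  by apply: measurable_funD; exact: measurable_funM.
have mF4 : measurable_fun [set: Omega] F4.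
  apply: measurable_sum => i.
  exact: (measurableT_comp (measurable_funX 4 mf) (mX i)).
have mD2 : measurable_fun [set: Omega] D2.
  by apply: measurable_funX; exact: measurable_funB.
have mrest : measurable_fun [set: Omega] rest.
  by apply: measurable_funD; exact: measurable_funM.
have dev0 w : 0 <= dev w by rewrite addr_ge0// mulr_ge0// addr_ge0// mulr_ge0.
have F40 w : 0 <= F4 w by apply: sumr_ge0 => i _; rewrite exprn_even_ge0.
have D20 w : 0 <= D2 w by exact: sqr_ge0.
have lam3 : 0 <= lam ^- 3 by rewrite invr_ge0 exprn_ge0// ltW.
have lam4 : 0 <= 4 * lam by rewrite mulr_ge0// ltW.
have rest0 w : 0 <= rest w by apply: addr_ge0; exact: mulr_ge0.
have B0 w : 0 < B w.
  rewrite mulr_gt0 ?invr_gt0 ?ltr0n// (bigD1 (Ordinal n_gt0))//= ltr_wpDr//.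
    by apply: sumr_ge0 => i _; rewrite ltW// divr_gt0 ?mulr1 ?proposal_gt0.
  by rewrite divr_gt0 ?mulr1 ?proposal_gt0.
apply: (@le_trans _ _ ('E_Pr[fun w => (1 * dev w + 1 * rest w)%R])%E).
  under eq_fun do rewrite (SNIS_ratio _ _ _ c0 n_gt0 ptE).
  apply: expectation_ge0_le => //.
  - apply: measurableT_comp => //; apply: measurable_funB => //.
    by apply: measurable_funM => //; exact: measurable_fun_inv_gt0.
  - by apply: measurable_funD; exact: measurable_funM.
  move=> w; rewrite !mul1r.
  apply: (@ratio_error _ n (fun i => p (X i w) / q w (X i w)) (fun i => f (X i w)))
    => //.
  - by move=> i; rewrite divr_gt0 ?proposal_gt0.
  - by congr (_ * _); apply: eq_bigr => i _; rewrite mulrAC.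
  - by congr (_ * _); apply: eq_bigr => i _; rewrite /= mulr1.
rewrite (expectation_ge0_linear Pr mdev mrest)// !mul1e.
have two0 : (0 : R) <= 2 by [].
set X4 := M * rho ^+ 3 + 4 * s ^+ 2 * rho.
have -> : (rn%:E * (sigma%:E + (ratio_remainder 2 + X4)%:E) =
    rn%:E * (sigma%:E + (ratio_remainder 2)%:E) + (rn * X4)%:E)%E.
  by rewrite -?EFinD -?EFinM -?EFinD; congr EFin; ring.
apply: leeD; first exact: expectation_ratio_error.
rewrite (expectation_ge0_linear Pr mF4 mD2)//.
apply: (@le_trans _ _ ((lam ^- 3)%:E * (n%:R * M)%:E +
    (4 * lam)%:E * ((rn * b') ^+ 2)%:E)%E).
  apply: leeD; apply: lee_wpmul2l; rewrite ?lee_fin//.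
    exact: expectation_fourth_power.
  exact: IS_one_mean_square_rate.
rewrite -!EFinM -EFinD lee_fin le_eqVlt; apply/orP; left; apply/eqP.
have nE : n%:R = Num.sqrt n%:R ^+ 2 :> R by rewrite sqr_sqrtr// ler0n.
rewrite [in n%:R * M]nE /lam /X4; field; rewrite !gt_eqF//.
Qed.

End error_bounds.

End fixed_proposal.

(** * Rates *)

Section rates_lemmas.
Context {R : realType}.
Implicit Types (eta : R) (M delta rho g : nat -> R).

(** With [h = N ^ (- eta / 2)], the square root of the mean integrated squared
    error is of order [h ^ 2] and [delta] is of order [h], so both terms of
    the rate are of order [h]. The summand [(N + 1) ^ (- eta)] keeps [m]
    positive when the error vanishes, without changing its order. That [h]
    tends to 0 is used to keep [1 - delta] away from 0. *)
Lemma excess_rate_bound M delta eta : 0 < eta -> (forall N, 0 <= M N) ->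
  (forall N, 0 < delta N < 1) ->
  M =O_\oo (fun N => N%:R `^ (- (2 * eta))) ->
  asymp delta (fun N => N%:R `^ (- (eta / 2))) ->
  exists2 C, 0 <= C & \forall N \near \oo,
    N%:R `^ (- (eta / 4)) <= 1 /\
    excess_rate (delta N) (Num.sqrt (M N) + N.+1%:R `^ (- eta)) <=
      (C * N%:R `^ (- (eta / 4))) ^+ 2.
Proof.
move=> eta0 M0 d01 /eqO_exP[k k0 Mk] [c [C [c0 C0 dcC]]].
exists (Num.sqrt ((Num.sqrt k + 1) / c + 2 * C)); first exact: sqrtr_ge0.
near=> N.
have N1 : 1 <= N%:R :> R by near: N; exact: nbhs_infty_ger.
have N0 : (0 < N)%N by rewrite -(ltr0n R) (lt_le_trans _ N1).
have N0' : 0 <= N%:R :> R by rewrite ler0n.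
have Npos : 0 < N%:R :> R by rewrite ltr0n.
have Nlarge : (2 * C) `^ (2 / eta) <= N%:R by near: N; exact: nbhs_infty_ger.
have MN : M N <= k * N%:R `^ (- (2 * eta)).
  have : `|M N| <= k * `|(N%:R : R) `^ (- (2 * eta))| by near: N.
  by rewrite !ger0_norm// powR_ge0.
set h := (N%:R : R) `^ (- (eta / 2)).
have h0 : 0 < h by rewrite powR_gt0.
have h4 : N%:R `^ (- (2 * eta)) = h ^+ 4.
  by rewrite -powR_mulrn ?powR_ge0// -powRrM; congr (_ `^ _); field.
have h2 : N%:R `^ (- eta) = h ^+ 2.
  by rewrite -powR_mulrn ?powR_ge0// -powRrM; congr (_ `^ _); field.
have hg : (N%:R `^ (- (eta / 4))) ^+ 2 = h.
  by rewrite -powR_mulrn ?powR_ge0// -powRrM; congr (_ `^ _); field.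
have g1 : (N%:R : R) `^ (- (eta / 4)) <= 1.
  rewrite -[leRHS](powRr0 N%:R) ler_powR// oppr_le0 divr_ge0// ltW//.
split => //.
have [d0 d1] := andP (d01 N).
have /andP[dc dC] := dcC N N0.
rewrite ler_pdivlMr// in dc; rewrite ler_pdivrMr// in dC.
have Ch : C * h <= 2^-1.
  have pos2C : 0 < 2 * C by rewrite mulr_gt0.
  have C2 : 2 * C <= N%:R `^ (eta / 2).
    have -> : 2 * C = ((2 * C) `^ (2 / eta)) `^ (eta / 2).
      have -> : (2 * C) `^ (2 / eta) `^ (eta / 2) = (2 * C) `^ 1.
        by rewrite -powRrM; congr (_ `^ _); field; rewrite gt_eqF.
      by rewrite powRr1// ltW.
    by apply: ge0_ler_powR; rewrite ?nnegrE ?powR_ge0// divr_ge0// ltW.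
  have hE : h * N%:R `^ (eta / 2) = 1.
    by rewrite /h powRN mulVf// gt_eqF// powR_gt0.
  have : h * (2 * C) <= 1 by rewrite -[leRHS]hE ler_wpM2l// ltW.
  by lra.
have mle : Num.sqrt (M N) + N.+1%:R `^ (- eta) <= (Num.sqrt k + 1) * h ^+ 2.
  rewrite mulrDl mul1r lerD//.
    rewrite (le_trans (ler_wsqrtr MN))// h4 sqrtrM ?(ltW k0)//.
    by rewrite (exprM h 2 2) sqrtr_sqr ger0_norm// exprn_ge0// ltW.
  rewrite -h2 !powRN lef_pV2 ?posrE ?powR_gt0 ?ltr0n//.
  by apply: ge0_ler_powR; rewrite ?nnegrE ?ler0n ?(ltW eta0)// ler_nat.
rewrite exprMn hg sqr_sqrtr; last first.
  by rewrite addr_ge0 ?divr_ge0 ?mulr_ge0 ?addr_ge0 ?sqrtr_ge0// ltW.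
rewrite mulrDl /excess_rate; apply: lerD.
  rewrite ler_pdivrMr//; apply: (le_trans mle).
  have -> : (Num.sqrt k + 1) * h ^+ 2 = (Num.sqrt k + 1) / c * h * (c * h).
    by field; rewrite gt_eqF.
  apply: ler_wpM2l => //; rewrite mulr_ge0 ?divr_ge0 ?addr_ge0 ?sqrtr_ge0//; exact: ltW.
have dhalf : delta N <= 2^-1 by apply: le_trans Ch.
rewrite ler_pdivrMr ?subr_gt0//; apply: (le_trans dC).
have Ch0 : 0 <= C * h by rewrite mulr_ge0// ltW.
have -> : 2 * C * h * (1 - delta N) = C * h * (2 * (1 - delta N)) by ring.
by apply: ler_peMr => //; lra.
Unshelve. all: by end_near.
Qed.

Lemma cubic_bigO rho g C (c1 c2 c3 : R) : 0 <= C ->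
  (forall N, 0 <= g N) -> (forall N, 0 <= rho N) ->
  (\forall N \near \oo, g N <= 1 /\ rho N <= C * g N) ->
  (fun N => c1 * rho N + c2 * rho N ^+ 2 + c3 * rho N ^+ 3) =O_\oo g.
Proof.
move=> C0 g0 rho0 rhog; apply/eqO_exP.
exists (`|c1| * C + `|c2| * C ^+ 2 + `|c3| * C ^+ 3 + 1).
  by rewrite ltr_wpDl// !addr_ge0// mulr_ge0// exprn_ge0.
near=> N.
have [g1 rg] : g N <= 1 /\ rho N <= C * g N by near: N.
rewrite (ger0_norm (g0 N)).
have gpow k : (C * g N) ^+ k.+1 <= C ^+ k.+1 * g N.
  rewrite exprMn ler_wpM2l ?exprn_ge0// exprS ler_piMr//.
  by rewrite exprn_ile1.
have term c k : `|c * rho N ^+ k.+1| <= `|c| * C ^+ k.+1 * g N.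
  rewrite normrM -mulrA ler_wpM2l// ger0_norm ?exprn_ge0//.
  apply: le_trans (gpow k); rewrite lerXn2r// nnegrE// ?mulr_ge0//.
apply: (@le_trans _ _ (`|c1| * C ^+ 1 * g N + `|c2| * C ^+ 2 * g N
   + `|c3| * C ^+ 3 * g N)); last by have := g0 N; rewrite expr1; lra.
apply: (le_trans (ler_normD _ _)); apply: lerD; last exact: term.
apply: (le_trans (ler_normD _ _)); apply: lerD; last exact: term.
by have := term c1 0%N; rewrite !expr1.
Unshelve. all: by end_near.
Qed.

End rates_lemmas.

(** * Convergence of the three estimators *)

Theorem corollary4p11 (R : realType)
    (dO : measure_display) (Omega : measurableType dO) (Pr : probability Omega R)
    (d : nat) (d_gt0 : (0 < d)%N)
    (P : probability (d.-tuple R) R) (p : d.-tuple R -> R)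
    (p_pdf : is_pdf p) (p_gt0 : forall x, 0 < p x) (P_p : has_density P p)
    (f : d.-tuple R -> R) (f_L2 : f \in Lfun P 2%:E)
    (phi : d.-tuple R -> R) (phi_pdf : is_pdf phi) (phi_gt0 : forall x, 0 < phi x)
    (delta : nat -> R) (delta01 : forall N, 0 < delta N < 1)
    (qN : nat -> Omega -> d.-tuple R -> R) (qN_pdf : forall N w, is_pdf (qN N w))
    (q : nat -> Omega -> d.-tuple R -> R)
    (qE : forall N w, q N w = defensive (delta N) (qN N w) phi)
    (Q : nat -> Omega -> pprobability (d.-tuple R) R)
    (Q_q : forall N w, has_density (Q N w) (q N w))
    (q_meas : forall N, measurable_given (Q N) (q N))
    (Fs : nat -> set_system Omega)
    (Fs_salg : forall N, sigma_algebra setT (Fs N))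
    (Fs_sub : forall N, Fs N `<=` measurable)
    (Q_meas : forall N, g_sigma_algebra_preimage (Q N) `<=` Fs N)
    (Q_dom : forall N, {ae Pr, forall w, P `<< Q N w})
    (X : forall N n : nat, 'I_n -> {RV Pr >-> d.-tuple R})
    (X_iid : forall N n, cond_iid Pr (Q N) (X N n))
    (Z : {RV Pr >-> d.-tuple R})
    (Z_P : forall A, measurable A -> distribution Pr Z A = P A)
    (Z_indep : forall N, indep_of Pr Z (Fs N))
    (int_f : ('N[P]_2%:E[(fun x => (f x ^+ 2 * Num.sqrt (p x) / phi x)%:E)] < +oo)%E)
    (int_1 : ('N[P]_2%:E[(fun x => (Num.sqrt (p x) / phi x)%:E)] < +oo)%E)
    (int_pphi : (\int[lebesgueRd d]_x (`|p x - phi x| * f x ^+ 2)%:E < +oo)%E)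
    (MISE_fin : forall N, (MISE Pr (qN N) p < +oo)%E)
    (eta : R) (eta_gt0 : 0 < eta)
    (MISE_O : (fun N => fine (MISE Pr (qN N) p)) =O_\oo
                (fun N => N%:R `^ (- (2 * eta))))
    (delta_asymp : asymp delta (fun N => N%:R `^ (- (eta / 2))))
    (c tau : R) (c_gt0 : 0 < c) (tau_gt0 : 0 < tau) (tau_c : tau < c)
    (pt : d.-tuple R -> R) (ptE : forall x, pt x = c * p x) :
  let I : R := \int[lebesgueRd d]_x (f x * p x) in
  let sd := sqrte ('V_Pr[f \o Z])%E in
  [/\ error_rate (fun N n =>
        ('E_Pr[fun w => `|IS p (q N w) f (fun i => X N n i w) - I|%R])%E) sd eta,
      (exists M : R, forall N,
         (\int[Pr]_w ('N[Q N w]_4%:E[EFin \o f] `^ 4) <= M%:E)%E) ->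
      error_rate (fun N n =>
        ('E_Pr[fun w => `|SNIS pt (q N w) f (fun i => X N n i w) - I|%R])%E) sd eta
    & error_rate (fun N n =>
        ('E_Pr[fun w => `|SNIS_trunc tau pt (q N w) f (fun i => X N n i w) - I|%R])%E)
        sd eta].
Proof.
move=> I sd.
have mp : measurable_fun [set: d.-tuple R] p by case: p_pdf.
have p1 : (\int[lebesgueRd d]_x (p x)%:E = 1)%E by case: p_pdf.
have [mphi _ phi1] := phi_pdf.
have mf : measurable_fun [set: d.-tuple R] f.
  by move: f_L2; rewrite inE => /andP[]; rewrite inE.
have fineE (e : \bar R) : (0 <= e)%E -> (e < +oo)%E -> exists2 r, 0 <= r & e = r%:E.
  by case: e => [r|//|//] e0 _; exists r.
have int0 (g : d.-tuple R -> R) : (forall x, 0 <= g x) ->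
    (0 <= \int[lebesgueRd d]_x (g x)%:E)%E.
  by move=> g0; apply: integral_ge0 => x _; rewrite lee_fin.
have [V V0 pfV] : exists2 V, 0 <= V & (\int[lebesgueRd d]_x (p x * f x ^+ 2)%:E = V%:E)%E.
  apply: fineE; last exact: (target_second_moment p_pdf P_p f_L2).
  by apply: int0 => x; rewrite mulr_ge0 ?sqr_ge0// ltW.
have pf_int := target_integrable p_pdf P_p f_L2.
have pfI : (\int[lebesgueRd d]_x (p x * f x)%:E = I%:E)%E.
  rewrite /I /Rintegral (eq_integral (fun x => (p x * f x)%:E)); last first.
    by move=> x _; rewrite mulrC.
  by rewrite fineK//; have := integrable_fin_num measurableT pf_int.
have fpI : (\int[lebesgueRd d]_x (f x * p x)%:E = I%:E)%E.
  by rewrite -pfI; apply: eq_integral => x _; rewrite mulrC.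
have [H H0 fH] : exists2 H, 0 <= H &
    (\int[lebesgueRd d]_x ((p x * f x ^+ 2 / phi x) ^+ 2)%:E = H%:E)%E.
  apply: fineE; first by apply: int0 => x; exact: sqr_ge0.
  by apply: (defensive_constant p_pdf P_p _ mphi phi_gt0 int_f); exact: measurable_funX.
have [H1 H10 oneH] : exists2 H1, 0 <= H1 &
    (\int[lebesgueRd d]_x ((p x / phi x) ^+ 2)%:E = H1%:E)%E.
  apply: fineE; first by apply: int0 => x; exact: sqr_ge0.
  have := @defensive_constant _ _ P p p_pdf P_p (cst 1) phi (measurable_cst _) mphi phi_gt0.
  rewrite (@eq_Lnorm _ _ _ P 2%:E _ (fun x => (Num.sqrt (p x) / phi x)%:E)); last first.
    by move=> x; rewrite /= mul1r.
  move=> /(_ int_1); apply: le_lt_trans; rewrite le_eqVlt; apply/orP; left; apply/eqP.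
  by apply: eq_integral => x _; rewrite mulr1.
have [K K0 fK] : exists2 K, 0 <= K &
    (\int[lebesgueRd d]_x (`|p x - phi x| * f x ^+ 2)%:E = K%:E)%E.
  by apply: fineE => //; apply: int0 => x; rewrite mulr_ge0// sqr_ge0.
have oneK : (\int[lebesgueRd d]_x (`|p x - phi x|)%:E <= 2%:E)%E.
  apply: (@le_trans _ _ (\int[lebesgueRd d]_x ((p x)%:E + (phi x)%:E))%E).
    apply: ge0_le_integral => //.
    - apply/measurable_EFinP; apply: measurableT_comp => //; exact: measurable_funB.
    - by apply: emeasurable_funD; exact/measurable_EFinP.
    move=> x _; rewrite -EFinD lee_fin (le_trans (ler_normB _ _))//.
    by rewrite !gtr0_norm.
  rewrite ge0_integralD//.
  - by rewrite p1 phi1.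
  - by move=> x _; rewrite lee_fin ltW.
  - exact/measurable_EFinP.
  - by move=> x _; rewrite lee_fin ltW.
  - exact/measurable_EFinP.
have varE := variance_of_target p_pdf P_p f_L2 Z_P pfV fpI.
have var0 : 0 <= V - I ^+ 2 by rewrite -lee_fin -varE variance_ge0.
pose sigma := Num.sqrt (V - I ^+ 2).
have sdE : sd = sigma%:E by rewrite /sd varE.
have sigma0 : 0 <= sigma by exact: sqrtr_ge0.
have sigmaE : V - I ^+ 2 = sigma ^+ 2 by rewrite sqr_sqrtr.
(* one constant serves both [f] and the constant function 1 *)
pose s := Num.sqrt ((1 + H + K) + (1 + H1 + 2)).
have s2 : s ^+ 2 = (1 + H + K) + (1 + H1 + 2) by rewrite sqr_sqrtr//; lra.
have s0 : 0 < s by rewrite sqrtr_gt0; lra.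
have s_f : 1 + H + K <= s ^+ 2 by rewrite s2; lra.
have s_one : 1 + H1 + 2 <= s ^+ 2 by rewrite s2; lra.
(* the second summand keeps [m N] positive *)
pose m N := Num.sqrt (fine (MISE Pr (qN N) p)) + N.+1%:R `^ (- eta).
have m0 N : 0 < m N by rewrite ltr_wpDl ?sqrtr_ge0// powR_gt0.
have MISE0 N : (0 <= MISE Pr (qN N) p)%E.
  by apply: integral_ge0 => w _; apply: int0 => x; exact: sqr_ge0.
have fMISE0 N : 0 <= fine (MISE Pr (qN N) p) by rewrite fine_ge0.
have MISEm N : (MISE Pr (qN N) p <= (m N ^+ 2)%:E)%E.
  rewrite -[leLHS]fineK ?ge0_fin_numE// lee_fin -[leLHS]sqr_sqrtr//.
  by rewrite lerXn2r ?nnegrE ?sqrtr_ge0 ?(ltW (m0 N))// lerDl powR_ge0.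
pose rho N := Num.sqrt (excess_rate (delta N) (m N)).
have rate0 N : 0 < excess_rate (delta N) (m N).
  have /andP[dN0 dN1] := delta01 N.
  by rewrite addr_gt0 ?divr_gt0 ?subr_gt0.
have rho0 N : 0 < rho N by rewrite sqrtr_gt0.
have rhoE N : excess_rate (delta N) (m N) = rho N ^+ 2 by rewrite sqr_sqrtr// ltW.
have [C C0 near_rho] := excess_rate_bound eta_gt0 fMISE0 delta01 MISE_O delta_asymp.
have cubicO c1 c2 c3 : (fun N => c1 * rho N + c2 * rho N ^+ 2 + c3 * rho N ^+ 3)
    =O_\oo (fun N => N%:R `^ (- (eta / 4))).
  apply: (cubic_bigO _ _ _ C0) => [N|N|]; [exact: powR_ge0|exact: ltW|].
  apply: filterS near_rho => N [g1 ratele]; split => //.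
  rewrite -(ler_pXn2r (n := 2)) ?nnegrE ?mulr_ge0 ?powR_ge0 ?(ltW (rho0 N))//.
  by rewrite -rhoE.
have Q_sub N : g_sigma_algebra_preimage (Q N) `<=` @measurable _ Omega.
  exact: (subset_trans (Q_meas N) (Fs_sub N)).
have pfV' : (\int[lebesgueRd d]_x (p x * f x ^+ 2)%:E <= V%:E)%E by rewrite pfV.
have fH' : (\int[lebesgueRd d]_x ((p x * f x ^+ 2 / phi x) ^+ 2)%:E <= H%:E)%E.
  by rewrite fH.
have fK' : (\int[lebesgueRd d]_x (`|p x - phi x| * f x ^+ 2)%:E <= K%:E)%E by rewrite fK.
have oneH' : (\int[lebesgueRd d]_x ((p x / phi x) ^+ 2)%:E <= H1%:E)%E by rewrite oneH.
rewrite sdE; split.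
- exists (fun N => s * rho N).
    by have := cubicO s 0 0; under eq_fun do rewrite !mul0r !addr0.
  move=> N n n0.
  exact: (IS_error p_pdf p_gt0 phi_pdf phi_gt0 (delta01 N) (qN_pdf N) (qE N) (Q_q N)
    (q_meas N) (Q_sub N) (m0 N) (MISEm N) n0 (X_iid N n) mf pf_int pfI pfV' fH' fK'
    sigma0 sigmaE s0 s_f (rho0 N) (rhoE N)).
- move=> [M fM].
  pose b := s + 2 * (sigma * s + `|I| * s) + 4 * s ^+ 2.
  exists (fun N => ratio_remainder I sigma s (rho N) 2 +
      (M * rho N ^+ 3 + 4 * s ^+ 2 * rho N)).
    suff -> : (fun N => ratio_remainder I sigma s (rho N) 2 +
        (M * rho N ^+ 3 + 4 * s ^+ 2 * rho N)) =
        (fun N => b * rho N + 2 * s ^+ 2 * rho N ^+ 2 + M * rho N ^+ 3).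
      exact: cubicO.
    by apply/funext => N; rewrite /ratio_remainder /b; ring.
  move=> N n n0.
  exact: (SNIS_error p_pdf p_gt0 phi_pdf phi_gt0 (delta01 N) (qN_pdf N) (qE N) (Q_q N)
    (q_meas N) (Q_sub N) (m0 N) (MISEm N) n0 (X_iid N n) mf pf_int pfI pfV' fH' fK'
    oneH' oneK sigma0 sigmaE s0 s_f s_one (rho0 N) (rhoE N) c_gt0 ptE (fM N)).
- pose t := (tau / c)^-1.
  exists (fun N => ratio_remainder I sigma s (rho N) t).
    suff -> : (fun N => ratio_remainder I sigma s (rho N) t) =
        (fun N => (s + t * (sigma * s + `|I| * s)) * rho N + t * s ^+ 2 * rho N ^+ 2
           + 0 * rho N ^+ 3).
      exact: cubicO.
    by apply/funext => N; rewrite /ratio_remainder; ring.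
  move=> N n n0.
  exact: (SNIS_trunc_error p_pdf p_gt0 phi_pdf phi_gt0 (delta01 N) (qN_pdf N) (qE N)
    (Q_q N) (q_meas N) (Q_sub N) (m0 N) (MISEm N) n0 (X_iid N n) mf pf_int pfI pfV' fH'
    fK' oneH' oneK sigma0 sigmaE s0 s_f s_one (rho0 N) (rhoE N) c_gt0 tau_gt0 tau_c ptE).
Qed.
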